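(* Let $d\in\mathbb N$ and let $S\subseteq\mathbb R^d$ be either (1) the limit set of an iterated function system, or (2) a real-analytic submanifold of $\mathbb R^d$. Suppose that $S$ does not contain a (nondegenerate) line segment. Then for every $\mathbf x\in S\setminus\mathbb Q^d$ there exists $C=C_{\mathbf x}>0$ such that infinitely many rational points $\mathbf p/q\in\mathbb Q^d\setminus S$ (with $\mathbf p\in\mathbb Z^d$, $q\in\mathbb N$) satisfy \[ \left\|\mathbf x-\frac{\mathbf p}{q}\right\|\le \frac{C}{q^{1+1/d}}. \] Moreover, the constants can be chosen so that the function $\mathbf x\mapsto C_{\mathbf x}$ is bounded on compact sets.
   Context: $\|\cdot\|$ denotes the max norm on $\mathbb R^d$. An iterated function system (IFS) on $\mathbb R^d$ is a finite collection $(u_a)_{a\in E}$ ($E$ a finite set) of contracting similarities $u_a:\mathbb R^d\to\mathbb R^d$ satisfying the open set condition: there is an open set $W\subseteq\mathbb R^d$ such that the sets $u_a(W)$, $a\in E$, are pairwise disjoint subsets of $W$. Its limit set is the image of the coding map $\pi:E^{\mathbb N}\to\mathbb R^d$, $\pi(\omega)=\lim_{n\to\infty}u_{\omega_1}\circ\cdots\circ u_{\omega_n}(\mathbf 0)$. *)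

(* Defs.v *)
From HB Require Import structures.
From mathcomp Require Import all_boot all_order all_algebra.
From mathcomp Require Import all_classical all_reals all_analysis.

Set Implicit Arguments.
Unset Strict Implicit.
Unset Printing Implicit Defensive.

Import Order.TTheory GRing.Theory Num.Theory.
Import numFieldNormedType.Exports.

Local Open Scope classical_set_scope.
Local Open Scope ring_scope.

(* R^d is 'rV[R]_d, whose library norm `|x| is the max norm.  The Euclidean
   norm is only used to define similarities: a similarity for the max norm
   could rotate only by signed coordinate permutations. *)
Definition enorm (R : realType) (d : nat) (x : 'rV[R]_d) : R :=
  Num.sqrt (\sum_(i < d) x 0 i ^+ 2).

Definition contracting_similarity (R : realType) (d : nat)
    (u : 'rV[R]_d -> 'rV[R]_d) : Prop :=
  exists r : R, [/\ 0 < r, r < 1 &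
    forall x y, enorm (u x - u y) = r * enorm (x - y)].

(* W must be nonempty, as the condition is vacuous for the empty set. *)
Definition open_set_condition (R : realType) (d : nat) (E : finType)
    (u : E -> 'rV[R]_d -> 'rV[R]_d) : Prop :=
  exists W : set 'rV[R]_d, [/\ open W, W !=set0,
    forall a, u a @` W `<=` W &
    trivIset [set: E] (fun a => u a @` W)].

Definition is_ifs (R : realType) (d : nat) (E : finType)
    (u : E -> 'rV[R]_d -> 'rV[R]_d) : Prop :=
  (forall a, contracting_similarity (u a)) /\ open_set_condition u.

(* The n-th term is u_(omega 0) (u_(omega 1) (... (u_(omega n.-1) 0))). *)
Definition coding_map (R : realType) (d : nat) (E : finType)
    (u : E -> 'rV[R]_d -> 'rV[R]_d) (omega : nat -> E) : 'rV[R]_d :=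
  lim ((fun n : nat => foldr (fun k y => u (omega k) y) 0 (iota 0 n)) @ \oo).

Definition limit_set (R : realType) (d : nat) (E : finType)
    (u : E -> 'rV[R]_d -> 'rV[R]_d) : set 'rV[R]_d :=
  range (coding_map u).

Definition is_ifs_limit_set (R : realType) (d : nat) (S : set 'rV[R]_d)
    : Prop :=
  exists (E : finType) (u : E -> 'rV[R]_d -> 'rV[R]_d),
    is_ifs u /\ S = limit_set u.

Definition monomial (R : realType) (d : nat) (alpha : {ffun 'I_d -> nat})
    (x : 'rV[R]_d) : R :=
  \prod_(i < d) x 0 i ^+ alpha i.

(* Multi-index power series: the family is absolutely summable, so that its
   sum can be computed along the boxes {0, ..., n.-1}^d of multi-indices. *)
Definition analytic_at (R : realType) (d : nat) (f : 'rV[R]_d -> R)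
    (a : 'rV[R]_d) : Prop :=
  exists (c : {ffun 'I_d -> nat} -> R) (r : R), 0 < r /\
    forall x, `|x - a| < r ->
      summable [set: {ffun 'I_d -> nat}]
        (fun alpha => (c alpha * monomial alpha (x - a))%:E) /\
      (fun n : nat => \sum_(beta : {ffun 'I_d -> 'I_n})
         let alpha := [ffun i => nat_of_ord (beta i)] in
         c alpha * monomial alpha (x - a)) @ \oo --> f x.

Definition analytic_on (R : realType) (d : nat) (U : set 'rV[R]_d)
    (g : 'rV[R]_d -> 'rV[R]_d) : Prop :=
  forall a, U a -> forall i : 'I_d, analytic_at (fun x => g x 0 i) a.

Definition analytic_diffeo (R : realType) (d : nat) (U V : set 'rV[R]_d)
    (phi psi : 'rV[R]_d -> 'rV[R]_d) : Prop :=
  [/\ open U /\ open V,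
      (forall x, U x -> V (phi x)) /\ (forall y, V y -> U (psi y)),
      (forall x, U x -> psi (phi x) = x) /\
        (forall y, V y -> phi (psi y) = y) &
      analytic_on U phi /\ analytic_on V psi].

(* Embedded, not necessarily closed or connected, of pure dimension k. *)
Definition analytic_submanifold (R : realType) (d : nat) (S : set 'rV[R]_d)
    : Prop :=
  exists k : nat, (k <= d)%N /\
    forall x, S x ->
      exists (U V : set 'rV[R]_d) (phi psi : 'rV[R]_d -> 'rV[R]_d),
        [/\ U x, analytic_diffeo U V phi psi &
            phi @` (U `&` S) =
            V `&` [set y | forall i : 'I_d, (k <= i)%N -> y 0 i = 0]].

Definition contains_segment (R : realType) (d : nat) (S : set 'rV[R]_d)
    : Prop :=
  exists a b : 'rV[R]_d, a <> b /\
    forall t : R, 0 <= t <= 1 -> S ((1 - t) *: a + t *: b).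

Definition ratpoint (R : realType) (d : nat) (p : 'rV[int]_d) (q : nat)
    : 'rV[R]_d :=
  q%:R^-1 *: map_mx intr p.
Arguments ratpoint R {d} p q.

Definition rational_points (R : realType) (d : nat) : set 'rV[R]_d :=
  [set y | forall i : 'I_d, exists z : rat, y 0 i = ratr z].
Arguments rational_points R d : clear implicits.

Definition extrinsic_approximants (R : realType) (d : nat)
    (S : set 'rV[R]_d) (x : 'rV[R]_d) (C : R) : set 'rV[R]_d :=
  [set y | ~ S y /\ exists (p : 'rV[int]_d) (q : nat),
    [/\ (0 < q)%N, y = ratpoint R p q &
        `|x - y| <= C / (q%:R `^ (1 + d%:R^-1))]].

(* Main.v *)
Require Import Defs.
From HB Require Import structures.
From mathcomp Require Import all_boot all_order all_algebra.
From mathcomp Require Import all_classical all_reals all_analysis.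
From mathcomp Require Import ring lra.

Set Implicit Arguments.
Unset Strict Implicit.
Unset Printing Implicit Defensive.

Import Order.TTheory GRing.Theory Num.Theory.
Import numFieldNormedType.Exports.

Local Open Scope classical_set_scope.
Local Open Scope ring_scope.

(* For irrational x, Dirichlet's theorem yields fractions a = p/q and b = p'/q'
   with q <= q' and errors |q x - p|, |q' x - p'| = O(q'^(-1/d)).  All the points
   (i p + p') / (i q + q') with i <= m lie on the line through a and b and
   approximate x to within O(m^2) times the required order, so it suffices that
   for some m, locally uniform in x, these m + 1 points cannot all be in S.

   If S is analytic, restrict a defining function to the lines near x: as S
   contains no segment, in every direction some Taylor coefficient is nonzero,
   which bounds the number of zeros of the restriction to nearby lines; the unit
   sphere being compact, the bound is uniform.

   If S is the limit set of an IFS, suppose that for every epsilon some chord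
   meets S in an epsilon-dense subset.  Points of the chord lie in boundedly many
   copies of S whose diameter is comparable to the length of the chord, by the
   open set condition.  Pull them back to S and take limits along an
   ultrafilter: one copy is hit by a set of parameters that is dense in some
   interval, and the limits of the pulled back points form a segment in S. *)

(** * Rational approximations on a line *)

Lemma rV_norm_le (R : realType) d (x : 'rV[R]_d) (e : R) :
  0 <= e -> (forall k, `|x 0 k| <= e) -> `|x| <= e.
Proof.
move=> e0 xe; have -> : `|x| = mx_norm x by [].
rewrite mx_normrE; apply: bigmax_le => // -[i k] _ /=.
by rewrite ord1.
Qed.

Lemma rV_norm_lt (R : realType) d (x : 'rV[R]_d) (e : R) :
  0 < e -> (forall k, `|x 0 k| < e) -> `|x| < e.
Proof.
move=> e0 xe; have -> : `|x| = mx_norm x by [].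
rewrite mx_normrE; apply: bigmax_lt => // -[i k] _ /=.
by rewrite ord1.
Qed.

Lemma rV_coord_le (R : realType) d (x : 'rV[R]_d) k : `|x 0 k| <= `|x|.
Proof.
have -> : `|x| = mx_norm x by [].
rewrite mx_normrE.
by apply: (@le_bigmax _ _ _ _ (fun ij : 'I_1 * 'I_d => `|x ij.1 ij.2|) (0, k)).
Qed.

(** Truncation of the coordinates places each point in one of [n ^ d] unit cubes, and two points in
    one cube are at distance less than 1. *)
Lemma box_pigeonhole (R : realType) d n N (g : 'I_N -> 'rV[R]_d) :
  (n ^ d < N)%N -> (forall i k, 0 <= g i 0 k < n%:R) ->
  exists i j : 'I_N, (i < j)%N /\ `|g i - g j| < 1.
Proof.
move=> nN gn.
have ltn i k : (Num.truncn (g i 0%R k) < n)%N.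
  have /andP[g0 gn'] := gn i k.
  by rewrite -(ltr_nat R); apply: le_lt_trans gn'; rewrite truncn_le.
pose c (i : 'I_N) : {ffun 'I_d -> 'I_n} := [ffun k => Ordinal (ltn i k)].
have /injectivePn [i [j ij cij]] : ~~ injectiveb c.
  apply/negP => /injectiveP /leq_card.
  by rewrite card_ffun !card_ord leqNgt nN.
have close k : `|g i 0 k - g j 0 k| < 1.
  have /andP[gi0 _] := gn i k; have /andP[gj0 _] := gn j k.
  have := truncn_itv gi0; have := truncn_itv gj0.
  have <- : Num.truncn (g i 0%R k) = Num.truncn (g j 0%R k).
    by move/ffunP/(_ k)/(congr1 val): cij; rewrite !ffunE.
  rewrite -natr1 ltr_norml; lra.
have lt1 a b : (forall k, `|g a 0 k - g b 0 k| < 1) -> `|g a - g b| < 1.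
  by move=> h; apply: rV_norm_lt => // k; rewrite !mxE.
case: (ltngtP i j) => [lij|lji|/val_inj eij]; last by rewrite eij eqxx in ij.
- by exists i, j; split => //; exact: lt1.
- by exists j, i; split => //; apply: lt1 => k; rewrite distrC.
Qed.

(** Among the [n ^ d + 1] points [i x] modulo 1, scaled by [n], two lie in one unit cube; the
    difference of their indices is [q]. *)
Lemma dirichlet (R : realType) d (x : 'rV[R]_d) (n : nat) : (0 < n)%N ->
  exists (q : nat) (p : 'rV[int]_d),
    [/\ (0 < q)%N, (q <= n ^ d)%N & `|q%:R *: x - map_mx intr p| < n%:R^-1].
Proof.
move=> n0; have n0' : (0 : R) < n%:R by rewrite ltr0n.
pose fl (i : nat) : 'rV[int]_d := \row_k Num.floor (i%:R * x 0 k).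
pose g (i : 'I_(n ^ d).+1) : 'rV[R]_d :=
  n%:R *: (i%:R *: x - map_mx intr (fl i)).
have gP i k : 0 <= g i 0 k < n%:R.
  rewrite !mxE; set y := _ * x 0 k.
  have /andP[] := floor_itv y.
  rewrite intrD => f1 f2; apply/andP; split; first by rewrite mulr_ge0 // subr_ge0.
  by rewrite gtr_pMr // ltrBlDl.
have [i [j [ij gij]]] := box_pigeonhole (ltnSn _) gP.
exists (j - i)%N, (fl j - fl i); split; first by rewrite subn_gt0.
  by rewrite (leq_trans (leq_subr _ _)) // -ltnS.
have eg : n%:R * `|(j - i)%N%:R *: x - map_mx intr (fl j - fl i)| = `|g i - g j|.
  rewrite distrC -scalerBr normrZ ger0_norm ?ltW //; congr (_ * `|_|).
  rewrite natrB ?(ltnW ij) // map_mxB scalerBl.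
  by apply/rowP => k; rewrite !mxE; ring.
by rewrite -[ltRHS]mul1r ltr_pdivlMr // mulrC eg.
Qed.

Lemma irrational_error_gt0 (R : realType) d (x : 'rV[R]_d) (q : nat) p :
  ~ rational_points R d x -> (0 < q)%N -> 0 < `|q%:R *: x - map_mx intr p|.
Proof.
move=> xQ q0; rewrite normr_gt0 subr_eq0; apply/eqP => qx; apply: xQ => k.
exists ((p 0 k)%:~R / q%:R).
rewrite rmorphM /= fmorphV /= ratr_int ratr_nat.
have /rowP/(_ k) := qx; rewrite !mxE => <-.
by rewrite mulrC mulKf // pnatr_eq0 -lt0n.
Qed.

(** The chain is [q^(1/d) <= n <= 1 / e + 1 <= 2 / e]. *)
Lemma denominator_bound (R : realType) d (e : R) (q n : nat) : (0 < d)%N ->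
  0 < e -> e <= 1 -> n = (Num.truncn e^-1).+1 -> (q <= n ^ d)%N ->
  e * q%:R `^ d%:R^-1 <= 2.
Proof.
move=> d0 e0 e1 -> qn; set n' := Num.truncn _ in qn *.
have en : n'.+1%:R <= 2 / e.
  rewrite -natr1.
  have : n'%:R <= e^-1 by rewrite truncn_le invr_ge0 ltW.
  have : 1 <= e^-1 by rewrite invf_ge1.
  by lra.
have : q%:R `^ d%:R^-1 <= n'.+1%:R :> R.
  have -> : n'.+1%:R = ((n'.+1 ^ d)%N%:R) `^ d%:R^-1 :> R.
    rewrite natrX -powR_mulrn // -powRrM mulfV ?powRr1 //.
    by rewrite pnatr_eq0 -lt0n.
  by apply: ge0_ler_powR; rewrite ?nnegrE ?invr_ge0 // ler_nat.
move/le_trans => /(_ _ en); rewrite ler_pdivlMr // mulrC; exact.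
Qed.

(** Take [q] least with error below [min eta 1], and [q'] least with error below the error [e] at
    [q]. Minimality of [q] gives [q <= q']; Dirichlet's theorem with [n] just above [1 / e] bounds
    [q']. *)
Lemma approximation_pair (R : realType) d (x : 'rV[R]_d) (eta : R) :
  (0 < d)%N -> ~ rational_points R d x -> 0 < eta ->
  exists (q q' : nat) (p p' : 'rV[int]_d) (e : R),
    [/\ [/\ (0 < q)%N, (q <= q')%N, 0 < e & e <= eta],
        `|q%:R *: x - map_mx intr p| = e, `|q'%:R *: x - map_mx intr p'| < e &
        e * q'%:R `^ d%:R^-1 <= 2].
Proof.
move=> d0 xQ eta0.
pose eta' := Num.min eta 1.
have eta'0 : 0 < eta' by rewrite lt_min eta0 ltr01.
pose good (e : R) (q : nat) := (0 < q)%N &&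
  `[< exists p : 'rV[int]_d, `|q%:R *: x - map_mx intr p| < e >].
have good_ex e : 0 < e -> exists2 q, good e q &
    (q <= (Num.truncn e^-1).+1 ^ d)%N.
  move=> e0.
  have [q [p [q0 qn qp]]] := dirichlet x (ltn0Sn (Num.truncn e^-1)).
  exists q => //; rewrite /good q0; apply/asboolP; exists p.
  apply: lt_trans qp _; rewrite invf_plt ?posrE ?ltr0n //.
  by rewrite truncnS_gt.
have gex e : 0 < e -> exists q, good e q by move=> /good_ex[q]; exists q.
case: (ex_minnP (gex _ eta'0)) => q /andP[q0 /asboolP[p qp]] qmin.
have e0 := irrational_error_gt0 p xQ q0.
set e := `|_| in e0 qp.
case: (ex_minnP (gex _ e0)) => q' /andP[q'0 /asboolP[p' q'p]] q'min.
have [q'' gq'' q''n] := good_ex _ e0.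
have eeta : e <= eta' by exact: ltW.
exists q, q', p, p', e; split => //.
  split => //; last by apply: le_trans eeta _; rewrite ge_min lexx.
  apply: qmin; rewrite /good q'0; apply/asboolP; exists p'.
  exact: lt_trans q'p qp.
apply: denominator_bound (erefl _) _ => //.
  by apply: le_trans eeta _; rewrite ge_min lexx orbT.
exact: leq_trans (q'min _ gq'') q''n.
Qed.

(* With b = p'/q', v = p/q - b and beta = q/q' this is the mediant
   (i p + p') / (i q + q'). *)
Definition projective_point (R : realType) d (b v : 'rV[R]_d) (beta : R)
    (i : nat) : 'rV[R]_d :=
  b + (i%:R * beta / (1 + i%:R * beta)) *: v.

(** The parameters are real and a single [eps] serves all of them, so the condition concerns the
    geometry of [S] near [x] alone and can be checked without reference to rational points. *)
Definition leaves_lines (R : realType) d (S : set 'rV[R]_d) (x : 'rV[R]_d)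
    (m : nat) : Prop :=
  exists2 eps : R, 0 < eps & forall b v beta, v != 0 -> 0 < beta ->
    (forall i, (i <= m)%N -> `|projective_point b v beta i - x| < eps) ->
    exists2 i, (i <= m)%N & ~ S (projective_point b v beta i).

Lemma projective_point_ratpoint (R : realType) d (p p' : 'rV[int]_d)
    (q q' i : nat) : (0 < q)%N -> (0 < q')%N ->
  projective_point (ratpoint R p' q') (ratpoint R p q - ratpoint R p' q')
    (q%:R / q'%:R) i = ratpoint R (p *+ i + p') (i * q + q').
Proof.
move=> q0 q'0; rewrite /projective_point /ratpoint.
have q1 : 0 < q%:R :> R by rewrite ltr0n.
have q'1 : 0 < q'%:R :> R by rewrite ltr0n.
have i0 : 0 <= i%:R :> R by rewrite ler0n.
have iq : 0 <= i%:R * q%:R :> R by rewrite mulr_ge0 // ltW.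
apply/rowP => k; rewrite !mxE mulmxnE !natrD natrM rmorphD rmorphMn /= -mulr_natl.
by field; rewrite !lt0r_neq0 //= ltr_wpDl // ltW.
Qed.

(** Numerators and denominators add, so the error at [Q = i q + q'] is at most
    [i e + e <= (m + 1) e]. As [Q <= (m + 1) q'], also [Q^(1/d) <= (m + 1) q'^(1/d)], and
    [e q'^(1/d) <= 2] yields the constant. *)
Lemma approximants_near (R : realType) d (S : set 'rV[R]_d) (x : 'rV[R]_d)
    (m : nat) (eta : R) :
  (0 < d)%N -> ~ rational_points R d x -> leaves_lines S x m -> 0 < eta ->
  exists2 y, extrinsic_approximants S x (2 * m.+1%:R ^+ 2) y & `|x - y| < eta.
Proof.
move=> d0 xQ [eps eps0 leave] eta0.
(* With this bound on [e], all the points [i <= m] are within [eps] of [x], as [leave] requires, and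
   within [eta], as the conclusion requires. *)
pose eta' := Num.min eps eta / (2 * m.+1%:R).
have m0 : 0 < m.+1%:R :> R by rewrite ltr0n.
have eta'0 : 0 < eta'.
  by rewrite divr_gt0 ?mulr_gt0 // lt_min eps0.
have [q [q' [p [p' [e [[q0 qq' e0 eeta]]]]]]] := approximation_pair d0 xQ eta'0.
move=> qp q'p' eq'.
have q'0 := leq_trans q0 qq'.
have Q0 i : (0 < i * q + q')%N by rewrite addn_gt0 q'0 orbT.
have err i : (i <= m)%N ->
    `|x - ratpoint R (p *+ i + p') (i * q + q')| <=
      m.+1%:R * e / (i * q + q')%:R.
  move=> im; have Qi : 0 < (i * q + q')%:R :> R by rewrite ltr0n.
  rewrite ler_pdivlMr // mulrC -[X in X * _](ger0_norm (ltW Qi)) -normrZ.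
  have -> : (i * q + q')%:R *: (x - ratpoint R (p *+ i + p') (i * q + q')) =
      i%:R *: (q%:R *: x - map_mx intr p) + (q'%:R *: x - map_mx intr p').
    rewrite /ratpoint scalerBr scalerA divff ?gt_eqF //.
    apply/rowP => k; rewrite !mxE mulmxnE !natrD natrM rmorphD rmorphMn /=.
    by rewrite -[_ *+ i]mulr_natl; ring.
  rewrite -natr1 mulrDl mul1r (le_trans (ler_normD _ _)) // lerD //.
    rewrite normrZ qp ger0_norm //.
    by rewrite ler_pM2r // ler_nat.
  by rewrite ltW.
have close i : (i <= m)%N ->
    `|x - ratpoint R (p *+ i + p') (i * q + q')| < Num.min eps eta.
  move=> im; apply: le_lt_trans (err i im) _.
  have minpos : 0 < Num.min eps eta by rewrite lt_min eps0.
  have : m.+1%:R * e <= Num.min eps eta / 2.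
    have := ler_wpM2l (ltW m0) eeta.
    by congr (_ <= _); rewrite /eta'; field; rewrite gt_eqF.
  have : m.+1%:R * e / (i * q + q')%:R <= m.+1%:R * e.
    rewrite ler_pdivrMr ?ltr0n // ler_peMr ?mulr_ge0 ?(ltW e0) //.
    by rewrite ler1n.
  lra.
pose b : 'rV[R]_d := ratpoint R p' q'.
pose v := ratpoint R p q - ratpoint R p' q'.
(* Equal fractions would have errors proportional to their denominators, but the error at [q'] is
   the smaller one although [q <= q']. *)
have v0 : v != 0.
  rewrite subr_eq0; apply/eqP => pq.
  have nq n (r : 'rV[int]_d) : (0 < n)%N ->
      `|n%:R *: x - map_mx intr r| = n%:R * `|x - ratpoint R r n|.
    move=> n0; rewrite -{2}(ger0_norm (ler0n R n)) -normrZ scalerBr.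
    by rewrite /ratpoint scalerA divff ?scale1r // pnatr_eq0 -lt0n.
  move: q'p'; rewrite -qp !nq // pq ltNge ler_wpM2r //.
  by rewrite ler_nat.
have [||i im nS] := leave b v (q%:R / q'%:R) v0; first by rewrite divr_gt0 ?ltr0n.
  move=> i im; rewrite projective_point_ratpoint // distrC.
  by apply: lt_le_trans (close i im) _; rewrite ge_min lexx.
rewrite projective_point_ratpoint // in nS.
exists (ratpoint R (p *+ i + p') (i * q + q')); last first.
  by apply: lt_le_trans (close i im) _; rewrite ge_min lexx orbT.
split=> //; exists (p *+ i + p'), (i * q + q')%N; split => //.
apply: le_trans (err i im) _.
set Q := (i * q + q')%N.
have Q1 : 0 < Q%:R :> R by rewrite ltr0n Q0.
rewrite powRD ?gt_eqF ?implybT // powRr1 ?ler0n // invfM mulrA.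
rewrite ler_pdivlMr ?powR_gt0 // mulrAC ler_pM2r ?invr_gt0 //.
have QM : Q%:R `^ d%:R^-1 <= m.+1%:R * q'%:R `^ d%:R^-1 :> R.
  have : Q%:R `^ d%:R^-1 <= (m.+1%:R * q'%:R) `^ d%:R^-1 :> R.
    apply: ge0_ler_powR; rewrite ?nnegrE ?invr_ge0 // ?mulr_ge0 //.
    rewrite -natrM ler_nat /Q mulSn addnC leq_add2l.
    exact: leq_mul.
  move/le_trans; apply; rewrite powRM //.
  apply: ler_wpM2r; first exact: powR_ge0.
  rewrite -[X in _ <= X]powRr1 //; apply: ler_powR; first by rewrite ler1n.
  by rewrite invf_le1 ?ltr0n // ler1n.
have := ler_wpM2l (mulr_ge0 (ltW m0) (ltW e0)) QM.
move/le_trans; apply.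
have := ler_wpM2l (ltW (exprn_gt0 2 m0)) eq'.
by rewrite [X in _ <= X]mulrC; congr (_ <= _); ring.
Qed.

Lemma infinite_near (R : realType) d (A : set 'rV[R]_d) (x : 'rV[R]_d) :
  ~ A x -> (forall eta : R, 0 < eta -> exists2 y, A y & `|x - y| < eta) ->
  infinite_set A.
Proof.
move=> Ax near fA; apply: Ax.
have [s As] : exists s : seq 'rV[R]_d, A = [set` s] by apply/finite_seqP.
suff : exists2 y, y \in s & `|x - y| <= 0.
  by move=> [y ys]; rewrite normr_le0 subr_eq0 As => /eqP ->.
apply: contrapT => noy.
have [eta eta0 etas] : exists2 eta : R, 0 < eta &
    forall y, y \in s -> eta <= `|x - y|.
  elim: s {As} noy => [|z s IH] noy; first by exists 1.
  have [|eta eta0 etas] := IH.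
    by move=> [y ys xy]; apply: noy; exists y => //; rewrite inE ys orbT.
  exists (Num.min eta `|x - z|).
    rewrite lt_min eta0 ltNge; apply/negP => xz.
    by apply: noy; exists z => //; rewrite inE eqxx.
  move=> y; rewrite inE => /orP[/eqP ->|/etas ye].
    by rewrite ge_min lexx orbT.
  by rewrite ge_min ye.
have [y + xy] := near eta eta0.
by rewrite As /= => /etas; rewrite leNgt xy.
Qed.

Lemma nbhs_rVP (R : realType) d (x : 'rV[R]_d) (P : set 'rV[R]_d) :
  nbhs x P <-> exists2 e : R, 0 < e & forall y, `|y - x| < e -> P y.
Proof.
split=> [/nbhs_ballP[e /= e0 xe]|[e e0 xe]].
  exists e => // y yx; apply: xe; rewrite mx_norm_ball /ball_ /=.
  by rewrite distrC.
apply/nbhs_ballP; exists e => //= y; rewrite mx_norm_ball /ball_ /= distrC.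
exact: xe.
Qed.

(** Half of [eps] absorbs the displacement of the centre. Keeping the same [m] is what makes the
    constants locally bounded. *)
Lemma leaves_lines_near (R : realType) d (S : set 'rV[R]_d) (x : 'rV[R]_d) m :
  leaves_lines S x m -> \forall y \near x, leaves_lines S y m.
Proof.
move=> [eps eps0 leave].
have eps2 : 0 < eps / 2 by rewrite divr_gt0.
apply/nbhs_rVP; exists (eps / 2) => // y yx.
exists (eps / 2) => // b v beta v0 beta0 close.
apply: leave => // i im; rewrite -(subrKA y) (le_lt_trans (ler_normD _ _)) //.
by have := close i im; lra.
Qed.

Lemma extrinsic_approximation (R : realType) d (S : set 'rV[R]_d) :
  (0 < d)%N -> (forall x, S x -> exists m, leaves_lines S x m) ->
  exists C : 'rV[R]_d -> R,
    (forall x, (S `\` rational_points R d) x ->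
       0 < C x /\ infinite_set (extrinsic_approximants S x (C x))) /\
    (forall K : set 'rV[R]_d, compact K -> K `<=` S ->
       exists M : R, forall x, (K `\` rational_points R d) x -> C x <= M).
Proof.
move=> d0 leave.
(* The least [m] that works at [x], with 0 as a filler where there is none. By minimality, any [m]
   that works at [x] bounds [mx] near [x]. *)
pose mx x : nat := match pselect (exists m, `[< leaves_lines S x m >]) with
  | left ex => ex_minn ex | right _ => 0 end.
have mxP x : S x -> leaves_lines S x (mx x).
  move=> /leave [m xm]; rewrite /mx; case: pselect => [ex|[]].
    by case: ex_minnP => n /asboolP.
  by exists m; apply/asboolP.
have mx_min x m : leaves_lines S x m -> (mx x <= m)%N.
  move=> xm; rewrite /mx; case: pselect => [ex|//].
  by case: ex_minnP => n _; apply; apply/asboolP.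
exists (fun x => 2 * (mx x).+1%:R ^+ 2); split.
  move=> x [Sx xQ]; split; first by rewrite mulr_gt0 ?exprn_gt0 ?ltr0n.
  apply: (@infinite_near _ _ _ x); first by case.
  by move=> eta eta0; apply: approximants_near => //; exact: mxP.
move=> K /compact_near_coveringP cK KS.
(* Compactness turns the local bounds on [mx] into one bound [n] valid on all of [K]. *)
have /(_ nat \oo (fun n x => (mx x <= n)%N) _) := cK.
case.
  move=> x Kx; have [m xm] := leave _ (KS _ Kx).
  near=> y n => /=; apply: (@leq_trans m).
    by apply: mx_min; near: y; exact: leaves_lines_near.
  by near: n; exact: nbhs_infty_ge.
move=> n _ /(_ n (leqnn n)) Kn.
exists (2 * n.+1%:R ^+ 2) => x [/Kn xn _].
by rewrite ler_pM2l // lerXn2r ?nnegrE // ler_nat.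
Unshelve. all: by end_near.
Qed.

(** * Zeros of analytic functions on lines *)

(** The hockey-stick identity carries the binomial bound on divided differences from order [k] to
    [k.+1]. *)
Lemma sum_binomial_upper n k : (\sum_(i < n) 'C(i, k))%N = 'C(n, k.+1).
Proof.
elim: n => [|n IH]; first by rewrite big_ord0.
by rewrite big_ord_recr /= IH binS.
Qed.

Lemma binomial_le_exp2 n k : ('C(n, k) <= 2 ^ n)%N.
Proof.
elim: n k => [|n IH] [|k] //; first by rewrite bin0 expn_gt0.
by rewrite binS expnS mul2n -addnn leq_add.
Qed.

(* The weights are those of the divided difference at the points of [s], which
   maps [x ^+ n] to a complete homogeneous polynomial of degree [n - k]. *)
Lemma divided_difference (R : realFieldType) (s : seq R) (k : nat) :
  uniq s -> size s = k.+1 -> (forall x, x \in s -> `|x| <= 1) ->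
  exists w : R -> R,
    (forall n, `|\sum_(x <- s) w x * x ^+ n| <= ('C(n, k))%:R) /\
    \sum_(x <- s) w x * x ^+ k = 1.
Proof.
elim: k s => [|k IH] [//|y s] /= /andP[ys us] [sz] s1.
  case: s sz {us ys} s1 => // _ s1; exists (fun=> 1); split.
    move=> n; rewrite big_seq1 mul1r bin0 normrX exprn_ile1 //.
    by apply: s1; rewrite inE eqxx.
  by rewrite big_seq1 mul1r expr0.
have [|w [wle wk]] := IH s us sz.
  by move=> x xs; apply: s1; rewrite inE xs orbT.
(* Adding the node [y] applies the previous functional to [(g x - g y) / (x - y)]. For
   [g x = x ^+ n] this quotient is the sum of the [y ^+ (n.-1 - i) * x ^+ i]. *)
pose w' x := if x == y then - \sum_(z <- s) w z / (z - y) else w x / (x - y).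
have w'E n : \sum_(x <- y :: s) w' x * x ^+ n =
    \sum_(i < n) y ^+ (n.-1 - i) * \sum_(x <- s) w x * x ^+ i.
  rewrite big_cons {1}/w' eqxx mulNr mulr_suml.
  rewrite [X in _ + X](_ : _ = \sum_(x <- s) w x / (x - y) * x ^+ n); last first.
    apply: eq_big_seq => x xs.
    have /negPf xy : x != y by apply: contraNneq ys => <-.
    by rewrite /w' xy.
  rewrite addrC -sumrB.
  rewrite [RHS](eq_bigr (fun i : 'I_n =>
      \sum_(x <- s) w x * (y ^+ (n.-1 - i) * x ^+ i))); last first.
    by move=> i _; rewrite mulr_sumr; apply: eq_bigr => x _; rewrite mulrCA.
  rewrite exchange_big /=; apply: eq_big_seq => x xs.
  have xy : x - y != 0 by rewrite subr_eq0; apply: contraNneq ys => <-.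
  rewrite -mulr_sumr -mulrBr -mulrA; congr (_ * _).
  rewrite -[x ^+ n - _]opprB subrXX -mulNr opprB mulKf //.
exists w'; split.
  move=> n; rewrite w'E -sum_binomial_upper natr_sum.
  apply: le_trans (ler_norm_sum _ _ _) _; apply: ler_sum => i _.
  apply: le_trans (wle i); rewrite normrM normrX ler_piMl // exprn_ile1 //.
  by apply: s1; rewrite inE eqxx.
rewrite w'E big_ord_recr /= subnn expr0 mul1r wk big1 ?add0r // => i _.
have := wle i; rewrite bin_small // normr_le0 => /eqP ->.
by rewrite mulr0.
Qed.

Section LinearFactors.
Variables (R : realFieldType) (s : seq R) (w : R -> R) (k : nat).
Hypothesis w_le : forall n, `|\sum_(x <- s) w x * x ^+ n| <= ('C(n, k))%:R.
Hypothesis w_k : \sum_(x <- s) w x * x ^+ k = 1.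

(* The weighted sum treats [f] as the divided difference of order [k] treats a
   product of [N] linear forms with coefficients at most 1 and leading
   coefficient [a]; the factor [x ^+ n] makes the property inductive in [N]. *)
Definition behaves_like_degree (N : nat) (a : R) (f : R -> R) : Prop :=
  forall n, [/\ `|\sum_(x <- s) w x * (x ^+ n * f x)| <= 2 ^+ n * 3 ^+ N,
    (n + N = k)%N -> \sum_(x <- s) w x * (x ^+ n * f x) = a &
    (n + N < k)%N -> \sum_(x <- s) w x * (x ^+ n * f x) = 0].

Lemma degree_one : behaves_like_degree 0 1 (fun=> 1).
Proof.
move=> n; rewrite addn0.
under eq_bigr do rewrite mulr1.
split=> [|->//|nk].
  rewrite expr0 mulr1 (le_trans (w_le n)) // -natrX ler_nat.
  exact: binomial_le_exp2.
by have := w_le n; rewrite bin_small // normr_le0 => /eqP.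
Qed.

(** A factor [b + x * v] splits the sum into those for [n] and [n.+1]. The base 3 arises here: [2 ^+
    n * 3 ^+ N + 2 ^+ n.+1 * 3 ^+ N = 2 ^+ n * 3 ^+ N.+1]. *)
Lemma degree_mul (N : nat) (a b v : R) (f : R -> R) : `|b| <= 1 -> `|v| <= 1 ->
  behaves_like_degree N a f ->
  behaves_like_degree N.+1 (v * a) (fun x => (b + x * v) * f x).
Proof.
move=> b1 v1 Nf n.
have -> : \sum_(x <- s) w x * (x ^+ n * ((b + x * v) * f x)) =
    b * (\sum_(x <- s) w x * (x ^+ n * f x)) +
    v * \sum_(x <- s) w x * (x ^+ n.+1 * f x).
  rewrite !mulr_sumr -big_split; apply: eq_bigr => x _ /=.
  by rewrite exprS; ring.
have [le0 eq0 lt0] := Nf n; have [le1 eq1 lt1] := Nf n.+1.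
split.
- apply: le_trans (ler_normD _ _) _; rewrite !normrM.
  have h0 := ler_pM (normr_ge0 b) (normr_ge0 _) b1 le0.
  have h1 := ler_pM (normr_ge0 v) (normr_ge0 _) v1 le1.
  apply: le_trans (lerD h0 h1) _.
  by rewrite !exprS le_eqVlt; apply/orP; left; apply/eqP; ring.
- move=> nk; rewrite lt0 -?nk ?addnS // mulr0 add0r eq1 //.
  by rewrite addSnnS.
- move=> nk; rewrite lt0 ?lt1 ?mulr0 ?addr0 // ?addSnnS //.
  by rewrite (leq_trans _ nk) // addnS leqW.
Qed.

(** On a line a monomial is a product of linear forms; they are multiplied in one at a time, by
    induction on the variables and then on the exponent. *)
Lemma degree_monomial (d : nat) (alpha : 'I_d -> nat) (b v : 'I_d -> R) :
  (forall i, `|b i| <= 1) -> (forall i, `|v i| <= 1) ->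
  behaves_like_degree (\sum_(i < d) alpha i) (\prod_(i < d) v i ^+ alpha i)
    (fun x => \prod_(i < d) (b i + x * v i) ^+ alpha i).
Proof.
move=> b1 v1.
have ext N a f g : f =1 g -> behaves_like_degree N a f ->
    behaves_like_degree N a g.
  by move=> fg Nf; rewrite -(funext fg).
elim: (index_enum _) => [|i r IH].
  rewrite !big_nil; apply: ext degree_one => x.
  by rewrite big_nil.
rewrite !big_cons.
apply: (ext _ _ (fun x => (b i + x * v i) ^+ alpha i *
  \prod_(j <- r) (b j + x * v j) ^+ alpha j)).
  by move=> x; rewrite big_cons.
elim: (alpha i) => [|m IHm].
  by rewrite expr0 mul1r; apply: ext IH => x; rewrite expr0 mul1r.
have := degree_mul (b1 i) (v1 i) IHm.
by rewrite mulrA -exprS; apply: ext => x; rewrite mulrA -exprS.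
Qed.
End LinearFactors.

(** * Power series summed over boxes of multi-indices *)

Definition box (d n : nat) : seq {ffun 'I_d -> nat} :=
  [seq [ffun i => nat_of_ord (beta i)] | beta : {ffun 'I_d -> 'I_n}].

Definition multidegree (d : nat) (alpha : {ffun 'I_d -> nat}) : nat :=
  (\sum_(i < d) alpha i)%N.

Lemma mem_box d n (alpha : {ffun 'I_d -> nat}) :
  (alpha \in box d n) = [forall i, (alpha i < n)%N].
Proof.
apply/mapP/forallP => [[beta _ ->] i|an]; first by rewrite ffunE.
exists [ffun i => Ordinal (an i)]; first by rewrite mem_enum.
by apply/ffunP => i; rewrite !ffunE.
Qed.

Lemma uniq_box d n : uniq (box d n).
Proof.
rewrite map_inj_uniq ?enum_uniq // => b b' /ffunP bb'.
by apply/ffunP => i; apply: val_inj; have := bb' i; rewrite !ffunE.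
Qed.

Lemma box_degree d n K (alpha : {ffun 'I_d -> nat}) : (K < n)%N ->
  multidegree alpha = K -> alpha \in box d n.
Proof.
move=> Kn aK; rewrite mem_box; apply/forallP => i.
apply: leq_ltn_trans Kn; rewrite -aK /multidegree (bigD1 i) //=.
exact: leq_addr.
Qed.

(** Every multi-index of degree [K] has entries at most [K], so each box larger than [K] contains
    all of them. *)
Lemma sum_box_degree (R : realType) d n K (F : {ffun 'I_d -> nat} -> R) :
  (K < n)%N ->
  \sum_(alpha <- box d n | multidegree alpha == K) F alpha =
  \sum_(alpha <- box d K.+1 | multidegree alpha == K) F alpha.
Proof.
move=> Kn; rewrite -big_filter -[RHS]big_filter; apply: perm_big.
apply: uniq_perm; rewrite ?filter_uniq ?uniq_box // => alpha.
rewrite !mem_filter; case: eqP => //= aK.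
by rewrite !(box_degree _ aK).
Qed.

Lemma sum_box (R : realType) d n (F : {ffun 'I_d -> nat} -> R) :
  \sum_(alpha <- box d n) F alpha =
  \sum_(beta : {ffun 'I_d -> 'I_n}) F [ffun i => nat_of_ord (beta i)].
Proof. by rewrite big_map big_enum. Qed.

Lemma summable_box_le (R : realType) d (F : {ffun 'I_d -> nat} -> R) :
  summable [set: {ffun 'I_d -> nat}] (fun alpha => (F alpha)%:E) ->
  exists2 A : R, 0 <= A & forall n, \sum_(alpha <- box d n) `|F alpha| <= A.
Proof.
rewrite summableE => /fineK eA.
set A := fine _ in eA; exists A.
  by apply: fine_ge0; apply: esum_ge0 => *; exact: abse_ge0.
move=> n; rewrite -lee_fin eA; apply: esum_ge.
exists [set` box d n] => //; first by split; [exact: finite_seq|].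
rewrite -fsbig_seq ?uniq_box //.
by rewrite sumEFin.
Qed.

Lemma monomialZ (R : realType) d (alpha : {ffun 'I_d -> nat}) (t : R) v :
  monomial alpha (t *: v) = t ^+ multidegree alpha * monomial alpha v.
Proof.
rewrite /monomial /multidegree expr_sum -big_split.
by apply: eq_bigr => i _; rewrite mxE exprMn.
Qed.

Lemma monomial_le1 (R : realType) d (alpha : {ffun 'I_d -> nat}) (v : 'rV[R]_d) :
  `|v| <= 1 -> `|monomial alpha v| <= 1.
Proof.
move=> v1; apply: (big_ind (fun y : R => `|y| <= 1)) => [|y z y1 z1|i _].
- by rewrite normr1.
- by rewrite normrM mulr_ile1.
- by rewrite normrX exprn_ile1 // (le_trans _ v1) // rV_coord_le.
Qed.

(** The box [K.+1] already holds all multi-indices of degree [K], so this finite sum is the whole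
    degree [K] part of the series. *)
Definition homogeneous_part (R : realType) d (c : {ffun 'I_d -> nat} -> R)
    (K : nat) (v : 'rV[R]_d) : R :=
  \sum_(alpha <- box d K.+1 | multidegree alpha == K) c alpha * monomial alpha v.

(* Apply the divided difference of order [k] at the points of [s] to the partial
   sums, which tend to 0 there: degrees below [k] vanish, degree [k] gives the
   homogeneous part at [v], and each higher degree gains a factor [eps]. *)
Lemma homogeneous_part_le (R : realType) d (c : {ffun 'I_d -> nat} -> R)
    (k : nat) (rho A eps : R) (s : seq R) (b v : 'rV[R]_d) :
  0 < rho -> 0 < eps -> 3 * eps <= rho ->
  (forall n, \sum_(alpha <- box d n) `|c alpha| * rho ^+ multidegree alpha <= A) ->
  `|b| <= 1 -> `|v| <= 1 ->
  uniq s -> size s = k.+1 -> (forall x, x \in s -> `|x| <= 1) ->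
  (forall x, x \in s ->
     \sum_(alpha <- box d n) c alpha * monomial alpha (eps *: (b + x *: v))
       @[n --> \oo] --> 0) ->
  `|homogeneous_part c k v| <= (3 / rho) ^+ k.+1 * A * eps.
Proof.
move=> rho0 eps0 eps_rho cA b1 v1 us sk s1 lim0.
have [w [w_le w_k]] := divided_difference us sk s1.
pose L (f : R -> R) := \sum_(x <- s) w x * f x.
have Lmon alpha : [/\ `|L (fun x => monomial alpha (b + x *: v))| <=
      3 ^+ multidegree alpha,
    (multidegree alpha = k)%N ->
      L (fun x => monomial alpha (b + x *: v)) = monomial alpha v &
    (multidegree alpha < k)%N -> L (fun x => monomial alpha (b + x *: v)) = 0].
  have b1' i : `|b 0 i| <= 1 by apply: le_trans b1; exact: rV_coord_le.
  have v1' i : `|v 0 i| <= 1 by apply: le_trans v1; exact: rV_coord_le.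
  have [] := degree_monomial w_le w_k alpha b1' v1' 0.
  have -> : \sum_(x <- s) w x * (x ^+ 0 *
      \prod_(i < d) (b 0 i + x * v 0 i) ^+ alpha i) =
      L (fun x => monomial alpha (b + x *: v)).
    apply: eq_bigr => x _; rewrite mul1r; congr (_ * _).
    by apply: eq_bigr => i _; rewrite !mxE.
  by rewrite expr0 mul1r.
pose Lb n := L (fun x => \sum_(alpha <- box d n)
  c alpha * monomial alpha (eps *: (b + x *: v))).
have Lb0 : Lb n @[n --> \oo] --> 0.
  rewrite {}/Lb; clear us sk s1 w_le w_k Lmon.
  rewrite {}/L; elim: s lim0 => [|y t IH] /= lim0.
    under eq_fun do rewrite big_nil.
    exact: cvg_cst.
  under eq_fun do rewrite big_cons.
  rewrite [X in nbhs X](_ : 0 = w y * 0 + 0); last by rewrite mulr0 addr0.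
  apply: cvgD; first by apply: cvgM; [exact: cvg_cst|apply: lim0; rewrite inE eqxx].
  by apply: IH => x xt; apply: lim0; rewrite inE xt orbT.
have LbE n : Lb n = \sum_(alpha <- box d n) c alpha *
    eps ^+ multidegree alpha * L (fun x => monomial alpha (b + x *: v)).
  rewrite /Lb /L.
  under eq_bigr do rewrite mulr_sumr.
  rewrite exchange_big /=; apply: eq_bigr => alpha _.
  rewrite mulr_sumr; apply: eq_bigr => x _.
  by rewrite monomialZ; ring.
(* Bounds the degrees above [k]: there [(3 * eps) ^+ D <= (3 * eps / rho) ^+ k.+1 * rho ^+ D] for
   the degree [D]. Dividing by [eps ^+ k] at the end leaves one factor [eps]. *)
pose T := (3 * eps / rho) ^+ k.+1 * A.
have main n : (k < n)%N -> `|eps ^+ k * homogeneous_part c k v| <= `|Lb n| + T.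
  move=> kn.
  have e3 : 0 <= 3 * eps / rho by rewrite !mulr_ge0 ?invr_ge0 ?ltW.
  have e31 : 3 * eps / rho <= 1 by rewrite ler_pdivrMr // mul1r.
  suff le_T : `|Lb n - eps ^+ k * homogeneous_part c k v| <= T.
    rewrite -(subrK (Lb n) (_ * _)) addrC (le_trans (ler_normD _ _)) //.
    by rewrite lerD2l distrC.
  have -> : Lb n - eps ^+ k * homogeneous_part c k v =
      \sum_(alpha <- box d n | (k < multidegree alpha)%N) c alpha *
        eps ^+ multidegree alpha * L (fun x => monomial alpha (b + x *: v)).
    rewrite LbE (bigID (fun alpha => multidegree alpha == k)) /=.
    rewrite [X in X + _ - _](_ : _ = eps ^+ k * homogeneous_part c k v); last first.
      rewrite /homogeneous_part -(sum_box_degree _ kn) [RHS]mulr_sumr.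
      apply: eq_bigr => alpha /eqP ak; have [_ -> // _] := Lmon alpha.
      by rewrite ak; ring.
    rewrite [LHS]addrC addKr [LHS]big_mkcond [RHS]big_mkcond /=.
    apply: eq_bigr => alpha _; case: ltngtP => //= ak.
    by have [_ _ -> //] := Lmon alpha; rewrite mulr0.
  rewrite (le_trans (ler_norm_sum _ _ _)) // /T.
  apply: le_trans (ler_wpM2l (exprn_ge0 _ e3) (cA n)).
  rewrite mulr_sumr [X in X <= _]big_mkcond; apply: ler_sum => alpha _.
  have rhs0 : 0 <= (3 * eps / rho) ^+ k.+1 *
      (`|c alpha| * rho ^+ multidegree alpha).
    by rewrite !mulr_ge0 // exprn_ge0 // ltW.
  case: ifP => // ka.
  rewrite !normrM normrX (ger0_norm (ltW eps0)).
  have [Ll _ _] := Lmon alpha.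
  apply: (@le_trans _ _ (`|c alpha| * eps ^+ multidegree alpha *
    3 ^+ multidegree alpha)).
    by apply: ler_wpM2l => //; rewrite mulr_ge0 // exprn_ge0 // ltW.
  rewrite mulrCA -mulrA; apply: ler_wpM2l => //.
  rewrite -exprMn mulrC.
  have -> : 3 * eps = (3 * eps / rho) * rho by rewrite divfK // gt_eqF.
  rewrite exprMn; apply: ler_wpM2r; first by rewrite exprn_ge0 // ltW.
  by rewrite mulfK ?gt_eqF //; exact: (ler_wiXn2l e3 e31 ka).
have : `|eps ^+ k * homogeneous_part c k v| <= T.
  apply/ler_addgt0Pl => e e0.
  have /cvgr0Pnorm_lt/(_ _ e0)[N _ LbN] := Lb0.
  have Nk : (k < maxn N k.+1)%N by rewrite leq_max leqnn orbT.
  apply: le_trans (main _ Nk) _; rewrite lerD2r ltW // LbN //=.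
  by rewrite leq_max leqnn.
rewrite normrM normrX (ger0_norm (ltW eps0)) mulrC -ler_pdivlMr ?exprn_gt0 //.
move/le_trans; apply; rewrite /T ler_pdivrMr ?exprn_gt0 //.
by rewrite !exprMn !exprS le_eqVlt; apply/orP; left; apply/eqP; ring.
Qed.

(** The box [n] contains the degrees below [n] completely, and these cancel. The remaining terms
    have degree at least [n], so [|t| <= rho / 2] makes their sum at most [A / 2 ^ n]. *)
Lemma homogeneous_parts_vanish (R : realType) d (c : {ffun 'I_d -> nat} -> R)
    (rho A t l : R) (v : 'rV[R]_d) :
  0 < rho -> `|v| <= 1 -> 2 * `|t| <= rho ->
  (forall n, \sum_(alpha <- box d n) `|c alpha| * rho ^+ multidegree alpha <= A) ->
  (forall K, homogeneous_part c K v = 0) ->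
  \sum_(alpha <- box d n) c alpha * monomial alpha (t *: v)
    @[n --> \oo] --> l -> l = 0.
Proof.
move=> rho0 v1 t_rho cA H0.
have bound n : `|\sum_(alpha <- box d n) c alpha * monomial alpha (t *: v)| <=
    A * 2^-1 ^+ n.
  rewrite (bigID (fun alpha => (multidegree alpha < n)%N)) /=.
  rewrite [X in X + _](_ : _ = 0) ?add0r; last first.
    rewrite (eq_bigr (fun alpha => \sum_(K < n | multidegree alpha == K)
        c alpha * monomial alpha (t *: v))); last first.
      move=> alpha an; by rewrite (big_pred1 (Ordinal an)).
    rewrite (exchange_big_dep xpredT) //= big1 // => K _.
    rewrite (eq_bigl (fun alpha => multidegree alpha == K)); last first.
      by move=> alpha; case: eqP => [->|]; rewrite ?ltn_ord ?andbF.
    rewrite sum_box_degree //.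
    transitivity (t ^+ K * homogeneous_part c K v); last by rewrite H0 mulr0.
    rewrite [RHS]mulr_sumr.
    by apply: eq_bigr => alpha /eqP aK; rewrite monomialZ aK; ring.
  rewrite (le_trans (ler_norm_sum _ _ _)) //.
  apply: le_trans (ler_wpM2r (exprn_ge0 _ _) (cA n)) => //.
  rewrite mulr_suml big_mkcond; apply: ler_sum => alpha _.
  have rhs0 : 0 <= `|c alpha| * rho ^+ multidegree alpha * 2^-1 ^+ n.
    by rewrite !mulr_ge0 // exprn_ge0 // ltW.
  case: ifP => //; rewrite -leqNgt => na.
  rewrite monomialZ !normrM normrX -mulrA ler_wpM2l //.
  have : `|t| ^+ multidegree alpha <=
      rho ^+ multidegree alpha * 2^-1 ^+ multidegree alpha.
    rewrite -exprMn lerXn2r ?nnegrE //; last by lra.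
    by rewrite divr_ge0 // ltW.
  have : 2^-1 ^+ multidegree alpha <= 2^-1 ^+ n :> R.
    by apply: (@ler_wiXn2l _ 2^-1) => //; lra.
  have := monomial_le1 alpha v1.
  have : 0 <= `|t| ^+ multidegree alpha by rewrite exprn_ge0.
  have : 0 <= rho ^+ multidegree alpha by rewrite exprn_ge0 // ltW.
  set T := `|t| ^+ _; set P := rho ^+ _; set H := 2^-1 ^+ _; set G := 2^-1 ^+ n.
  move=> P0 T0 m1 HG TPH.
  apply: (@le_trans _ _ T); first by rewrite ler_piMr.
  by rewrite (le_trans TPH) // ler_wpM2l.
move=> cv.
have : (fun n => A * 2^-1 ^+ n) @ \oo --> (0 : R).
  rewrite -[X in _ --> X](mulr0 A).
  apply: cvgM; first exact: cvg_cst.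
  by apply: cvg_expr; rewrite ger0_norm //; lra.
move=> hcv.
have sq : `|\sum_(alpha <- box d n) c alpha * monomial alpha (t *: v)|
    @[n --> \oo] --> (0 : R).
  apply: (squeeze_cvgr _ (cvg_cst 0) hcv).
  by apply: nearW => n; rewrite normr_ge0 bound.
apply/eqP; rewrite -normr_eq0; apply/eqP.
apply: cvg_unique sq => //.
by apply: cvg_norm.
Qed.

Lemma homogeneous_part_continuous (R : realType) d
    (c : {ffun 'I_d -> nat} -> R) K : continuous (homogeneous_part c K).
Proof.
have cpow alpha i : continuous (fun v : 'rV[R]_d => v 0 i ^+ alpha i).
  move=> v; apply: (@continuous_comp _ _ _ (fun v : 'rV[R]_d => v 0 i)
    (fun y => y ^+ alpha i)).
    exact: coord_continuous.
  exact: exprn_continuous.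
have cmon alpha : continuous (fun v : 'rV[R]_d => c alpha * monomial alpha v).
  move=> v; have cc : {for v, continuous (fun=> c alpha)} by exact: cst_continuous.
  apply: (continuousM cc).
  exact: (continuous_big (@mul_continuous R) (fun i _ => cpow alpha i)).
exact: (continuous_big (@add_continuous R) (fun alpha _ => cmon alpha)).
Qed.

Lemma norm_const_mx (R : realType) d (a : R) : `|const_mx a : 'rV[R]_d| <= `|a|.
Proof. by apply: rV_norm_le => // k; rewrite mxE. Qed.

(** If all homogeneous parts vanish at [v], so does [f] on the line near [a]. Otherwise the part of
    some degree [k] stays away from 0 for directions near [v], whereas [k.+1] zeros close to [a]
    would make it small. *)
Lemma analytic_line_dichotomy (R : realType) d (f : 'rV[R]_d -> R)
    (a v : 'rV[R]_d) : analytic_at f a -> `|v| <= 1 ->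
  (exists2 e : R, 0 < e & forall t, `|t| < e -> f (a + t *: v) = 0) \/
  (exists (k : nat) (e : R), 0 < e /\ forall v', `|v'| <= 1 -> `|v' - v| < e ->
     forall b, `|b - a| < e -> forall s : seq R, uniq s -> size s = k.+1 ->
     (forall t, t \in s -> `|t| < e) ->
     exists2 t, t \in s & f (b + t *: v') != 0).
Proof.
move=> [c [r [r0 fr]]] v1.
pose rho := r / 2; have rho0 : 0 < rho by rewrite divr_gt0.
have rho_r : 2 * rho = r by rewrite mulrC divfK.
have [A A0 cA] : exists2 A : R, 0 <= A & forall n,
    \sum_(alpha <- box d n) `|c alpha| * rho ^+ multidegree alpha <= A.
  (* At the displacement with all coordinates [rho], a monomial equals [rho] to the power of its
     degree, so summability there bounds the coefficients. *)
  have [|/summable_box_le[A A0 cA] _] := fr (a + const_mx rho).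
    rewrite addrC addKr (le_lt_trans (norm_const_mx _ _)) // ger0_norm ?ltW //.
    by lra.
  exists A => // n; apply: le_trans (cA n); rewrite le_eqVlt; apply/orP; left.
  apply/eqP; apply: eq_bigr => alpha _; rewrite normrM addrC addKr.
  have -> : const_mx rho = rho *: const_mx 1 :> 'rV[R]_d.
    by apply/rowP => i; rewrite !mxE mulr1.
  rewrite monomialZ [monomial _ _]big1 ?mulr1; last first.
    by move=> i _; rewrite mxE expr1n.
  by rewrite normrX (ger0_norm (ltW rho0)).
have cvf x : `|x| < r ->
    \sum_(alpha <- box d n) c alpha * monomial alpha x @[n --> \oo] --> f (a + x).
  move=> xr; have [|_] := fr (a + x); first by rewrite addrC addKr.
  rewrite addrC addKr.
  under eq_fun => n do rewrite -(sum_box n (fun al => c al * monomial al x)).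
  by [].
have [H0|/existsNP[k /eqP Hk]] := pselect (forall K, homogeneous_part c K v = 0).
  left; exists (rho / 2); first by rewrite divr_gt0.
  move=> t tr; apply: (@homogeneous_parts_vanish _ _ c rho A t _ v) => //.
    by move: `|t| tr => ? ?; lra.
  apply: cvf; rewrite normrZ.
  by rewrite (le_lt_trans (ler_piMr _ v1)) // (lt_le_trans tr) // -rho_r; lra.
right.
pose h := `|homogeneous_part c k v| / 2.
have h0 : 0 < h by rewrite divr_gt0 // normr_gt0.
have [e1 e10 He1] : exists2 e1 : R, 0 < e1 & forall v', `|v' - v| < e1 ->
    h < `|homogeneous_part c k v'|.
  apply/nbhs_rVP.
  have /(_ v)/cvgr_dist_lt/(_ h h0) := @homogeneous_part_continuous R d c k.
  apply: filterS => v' /= vv'.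
  have := lerB_dist (homogeneous_part c k v) (homogeneous_part c k v').
  by move: vv'; rewrite /h; lra.
pose Q := (3 / rho) ^+ k.+1 * A.
have Q0 : 0 <= Q by rewrite mulr_ge0 // exprn_ge0 // divr_ge0 // ltW.
have Q1 : 0 < Q + 1 by lra.
(* The first bound is required by [homogeneous_part_le]; the second puts its conclusion [Q * eps]
   below [h], with [Q + 1] because [Q] may be 0. *)
pose eps := Num.min (rho / 3) (h / (Q + 1)).
have eps0 : 0 < eps.
  rewrite lt_min; apply/andP; split; first by rewrite divr_gt0.
  by rewrite divr_gt0.
have eps_rho : 3 * eps <= rho.
  have : eps <= rho / 3 by rewrite ge_min lexx.
  by lra.
have Qeps : Q * eps < h.
  have : eps <= h / (Q + 1) by rewrite ge_min lexx orbT.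
  by rewrite ler_pdivlMr // => ?; nra.
exists k, (Num.min e1 eps); split; first by rewrite lt_min e10.
move=> v' v'1 v'v b ba s us sk st; apply: contrapT => noz.
have {}noz t : t \in s -> f (b + t *: v') = 0.
  by move=> ts; apply: contrapT => /eqP ft; apply: noz; exists t.
have : `|homogeneous_part c k v'| <= Q * eps.
  (* Rescaling by [eps^-1] brings the base point and the parameters into the unit range. *)
  apply: (@homogeneous_part_le _ _ c k rho A eps [seq eps^-1 * t | t <- s]
    (eps^-1 *: (b - a)) v') => //.
  - rewrite normrZ ger0_norm ?invr_ge0 ?(ltW eps0) // mulrC ler_pdivrMr // mul1r.
    by rewrite ltW // (lt_le_trans ba) // ge_min lexx orbT.
  - rewrite map_inj_uniq //; apply: mulfI; by rewrite invr_neq0 // gt_eqF.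
  - by rewrite size_map.
  - move=> _ /mapP[t ts ->].
    rewrite normrM ger0_norm ?invr_ge0 ?(ltW eps0) // mulrC ler_pdivrMr // mul1r.
    by rewrite ltW // (lt_le_trans (st _ ts)) // ge_min lexx orbT.
  move=> _ /mapP[t ts ->].
  rewrite scalerDr !scalerA mulrA divff ?gt_eqF // scale1r mul1r.
  have := cvf (b - a + t *: v'); rewrite addrA subrKC noz //; apply.
  rewrite (le_lt_trans (ler_normD _ _)) //.
  have : `|b - a| < eps by rewrite (lt_le_trans ba) // ge_min lexx orbT.
  have : `|t| < eps by rewrite (lt_le_trans (st _ ts)) // ge_min lexx orbT.
  have : `|t *: v'| <= `|t| by rewrite normrZ ler_piMr.
  by lra.
have : h < `|homogeneous_part c k v'|.
  by apply: He1; rewrite (lt_le_trans v'v) // ge_min lexx.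
by lra.
Qed.

(** If all the [f i] vanished along a direction, [S] would contain a segment; so for each direction
    one of them bounds the number of points of [S] on nearby lines. Compactness of the unit sphere
    makes the bound uniform. *)
Lemma analytic_zeros_leave_lines (R : realType) d (S : set 'rV[R]_d)
    (x0 : 'rV[R]_d) (P : pred 'I_d) (f : 'I_d -> 'rV[R]_d -> R) (r : R) :
  0 < r -> (forall i, P i -> analytic_at (f i) x0) ->
  (forall x, `|x - x0| < r -> S x <-> forall i, P i -> f i x = 0) ->
  ~ contains_segment S -> exists m, leaves_lines S x0 m.
Proof.
move=> r0 fan SE noseg.
(* One integer controls both the number of points and the radius. The condition weakens as [n]
   grows, so local bounds combine along [\oo]. *)
pose bounded_zeros (n : nat) (v : 'rV[R]_d) := `|v| <= 1 -> forall b, `|b - x0| < n.+1%:R^-1 ->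
  forall s : seq R, uniq s -> size s = n.+1 ->
    (forall t, t \in s -> `|t| < n.+1%:R^-1) ->
    exists2 t, t \in s & ~ S (b + t *: v).
have local v : `|v| = 1 ->
    exists (k : nat) (e : R), 0 < e /\ forall v', `|v'| <= 1 -> `|v' - v| < e ->
     forall b, `|b - x0| < e -> forall s : seq R, uniq s -> size s = k.+1 ->
     (forall t, t \in s -> `|t| < e) -> exists2 t, t \in s & ~ S (b + t *: v').
  move=> v1; apply: contrapT => nolocal; apply: noseg.
  have v1' : `|v| <= 1 by rewrite v1.
  have [e e0 fe] : exists2 e : R, 0 < e &
      forall i, P i -> forall t, `|t| < e -> f i (x0 + t *: v) = 0.
    have dich i : exists2 e : R, 0 < e &
        P i -> forall t, `|t| < e -> f i (x0 + t *: v) = 0.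
      have [Pi|] := boolP (P i); last by exists 1.
      have [[e e0 fe]|[k [e [e0 He]]]] := analytic_line_dichotomy (fan i Pi) v1'.
        by exists e.
      exfalso; apply: nolocal; exists k, (Num.min e (r / 2)); split.
        by rewrite lt_min e0 divr_gt0.
      move=> v' v'1; rewrite lt_min => /andP[v'v _] b.
      rewrite lt_min => /andP[ba br] s us sk st.
      have [|t ts ft] := He v' v'1 v'v b ba s us sk.
        by move=> t /st; rewrite lt_min => /andP[].
      exists t => // St.
      have near_x0 : `|b + t *: v' - x0| < r.
        rewrite addrAC (le_lt_trans (ler_normD _ _)) //.
        have := st t ts; rewrite lt_min => /andP[_].
        have : `|t *: v'| <= `|t| by rewrite normrZ ler_piMr.
        by lra.
      by have /eqP := (SE _ near_x0).1 St i Pi; rewrite (negPf ft).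
    pose e i := projT1 (cid2 (dich i)).
    exists (\big[Num.min/1]_i e i).
      apply: (big_ind (fun y : R => 0 < y)) => // [x y x0' y0'|i _].
        by rewrite lt_min x0'.
      by rewrite /e; case: cid2.
    move=> i Pi t te; move: (bigmin_le_cond 1 e (erefl (xpredT i))) => ei.
    have {}te := lt_le_trans te ei.
    by move: te; rewrite /e; case: cid2 => e' e'0 /= /(_ Pi); apply.
  pose a := Num.min e r / 2.
  have a0 : 0 < a by rewrite divr_gt0 // lt_min e0.
  have ae : a < e by rewrite ltr_pdivrMr // gt_min; apply/orP; left; lra.
  have ar : a < r by rewrite ltr_pdivrMr // gt_min; apply/orP; right; lra.
  exists x0, (x0 + a *: v); split.
    move/eqP; rewrite -subr_eq0 opprD addNKr oppr_eq0 scaler_eq0 gt_eqF //=.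
    by rewrite -normr_eq0 v1 oner_eq0.
  move=> t /andP[t0 t1].
  have -> : (1 - t) *: x0 + t *: (x0 + a *: v) = x0 + (t * a) *: v.
    by apply/rowP => i; rewrite !mxE; ring.
  have ta : `|t * a| <= a 
    by rewrite normrM (ger0_norm t0) (ger0_norm (ltW a0)) ler_piMl // ltW.
  apply/SE; first by rewrite addrC addKr normrZ v1 mulr1 (le_lt_trans ta).
  by move=> i Pi; apply: fe => //; exact: le_lt_trans ta ae.
have [N zerosN] : exists N, forall v, `|v| = 1 -> bounded_zeros N v.
  pose K : set 'rV[R]_d := [set v | `|v| = 1].
  have /compact_near_coveringP cK : compact K.
    apply: bounded_closed_compact.
      exists 1; split; first exact: num_real.
      by move=> y y1 v Kv; rewrite /= Kv ltW.
    apply: (@closed_comp _ _ (fun v : 'rV[R]_d => `|v|) [set 1]); last exact: closed_eq.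
    by move=> v _; exact: norm_continuous.
  have := cK nat \oo bounded_zeros; case => [v v1|N _ NK].
    have [k [e [e0 He]]] := local v v1.
    pose N := (maxn k (Num.truncn e^-1)).
    exists ([set v' | `|v' - v| < e], [set n | (N <= n)%N]).
      split; [by apply/nbhs_rVP; exists e | by exists N].
    move=> [v' n] /= [v'v Nn] v'1 b bx s us sn st.
    have kn : (k <= n)%N by apply: leq_trans Nn; exact: leq_maxl.
    have ne : n.+1%:R^-1 <= e.
      rewrite invf_ple ?posrE ?ltr0n // ltW //.
      have := truncnS_gt e^-1; move=> /lt_le_trans; apply.
      by rewrite ler_nat ltnS (leq_trans _ Nn) // leq_maxr.
    have [||||t ts] := He v' v'1 v'v b _ (take k.+1 s).
    - exact: lt_le_trans ne.
    - exact: take_uniq.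
    - by rewrite size_takel // sn ltnS.
    - by move=> t /mem_take /st /lt_le_trans; apply.
    by exists t => //; exact: mem_take ts.
  by exists N => v v1; apply: NK => /=.
(* The radius is halved because [theta i] measures the distance between two points near [x0], namely
   [b], the point of index 0, and the point of index [i]. *)
exists N, (N.+1%:R^-1 / 2); first by rewrite divr_gt0 ?invr_gt0.
move=> b v beta v0 beta0 close.
have nv0 : 0 < `|v| by rewrite normr_gt0.
pose theta (i : nat) : R := i%:R * beta / (1 + i%:R * beta) * `|v|.
pose w := `|v|^-1 *: v.
have w1 : `|w| = 1 by rewrite normrZ gtr0_norm ?invr_gt0 // mulVf // gt_eqF.
have pE i : projective_point b v beta i = b + theta i *: w.
  by rewrite /projective_point /theta /w scalerA mulfK // gt_eqF.
have p0 : projective_point b v beta 0 = b.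
  by rewrite /projective_point !mul0r scale0r addr0.
have bx : `|b - x0| < N.+1%:R^-1 / 2 by rewrite -p0; exact: close.
have N0 : 0 < N.+1%:R^-1 :> R by rewrite invr_gt0.
have [||||| t] := zerosN w w1 _ b _ [seq theta i | i <- iota 0 N.+1].
- by rewrite w1.
- by rewrite (lt_trans bx) // gtr_pMr // invf_lt1 // ltr1n.
- rewrite (map_inj_uniq (f := theta)) ?iota_uniq // => i j /(mulIf (lt0r_neq0 nv0)).
  have i0 : 0 < 1 + i%:R * beta by rewrite ltr_wpDr // mulr_ge0 // ltW.
  have j0 : 0 < 1 + j%:R * beta by rewrite ltr_wpDr // mulr_ge0 // ltW.
  move/eqP; rewrite (eqr_div _ _ (lt0r_neq0 i0) (lt0r_neq0 j0)) => /eqP ij.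
  have : i%:R * beta = j%:R * beta by lra.
  by move/(mulIf (lt0r_neq0 beta0))/eqP; rewrite eqr_nat => /eqP.
- by rewrite size_map size_iota.
- move=> t /mapP[i]; rewrite mem_iota add0n ltnS => /= iN ->.
  have -> : `|theta i| = `|(projective_point b v beta i - x0) - (b - x0)|.
    by rewrite opprB addrA subrK pE [b + _]addrC addrK [RHS]normrZ w1 mulr1.
  rewrite (le_lt_trans (ler_normB _ _)) // [X in _ < X]splitr ltrD //; exact: close.
move=> /mapP[i]; rewrite mem_iota add0n ltnS => /= iN -> nS.
by exists i => //; rewrite pE.
Qed.

(** Near [x], the coordinates of the chart with index at least [k] are analytic equations of [S];
    injectivity of the chart shows that their common zeros lie in [S]. *)
Lemma analytic_submanifold_leaves_lines (R : realType) d (S : set 'rV[R]_d) x :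
  analytic_submanifold S -> ~ contains_segment S -> S x ->
  exists m, leaves_lines S x m.
Proof.
move=> [k [kd charts]] noseg Sx.
have [U [V [phi [psi [Ux [[oU oV] [phiV psiU] [psiK phiK] [phian _]] phiS]]]]] :=
  charts x Sx.
have /nbhs_rVP[r r0 rU] : nbhs x U by exact: open_nbhs_nbhs.
apply: (@analytic_zeros_leave_lines R d S x (fun i : 'I_d => (k <= i)%N)
  (fun i y => phi y 0 i) r) => //.
  by move=> i _; exact: phian.
move=> y /rU Uy; split.
  move=> Sy; have : (phi @` (U `&` S)) (phi y) by exists y.
  by rewrite phiS => -[].
move=> y0; have : (phi @` (U `&` S)) (phi y) by rewrite phiS; split; [exact: phiV|].
by move=> [z [Uz Sz] /(congr1 psi)]; rewrite !psiK // => <-.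
Qed.

(** * The Euclidean norm and similarities *)

Section EuclideanNorm.
Variables (R : realType) (d : nat).
Implicit Types x y z : 'rV[R]_d.

Definition dot x y : R := \sum_(i < d) x 0 i * y 0 i.

Lemma enorm_ge0 x : 0 <= enorm x. Proof. exact: sqrtr_ge0. Qed.

Lemma enorm_sqr x : enorm x ^+ 2 = dot x x.
Proof.
rewrite sqr_sqrtr; last by apply: sumr_ge0 => i _; exact: sqr_ge0.
by apply: eq_bigr => i _; rewrite expr2.
Qed.

Lemma enorm_sqrB x y : enorm (x - y) ^+ 2 = enorm x ^+ 2 + enorm y ^+ 2 - 2 * dot x y.
Proof.
rewrite !enorm_sqr /dot mulr_sumr -big_split -sumrB; apply: eq_bigr => i _ /=.
by rewrite !mxE; ring.
Qed.

Lemma enormZ (a : R) x : enorm (a *: x) = `|a| * enorm x.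
Proof.
rewrite /enorm -sqrtr_sqr -sqrtrM ?sqr_ge0 // mulr_sumr.
by congr Num.sqrt; apply: eq_bigr => i _; rewrite mxE exprMn.
Qed.

Lemma enorm0 : enorm (0 : 'rV[R]_d) = 0.
Proof. by rewrite -(scale0r (0 : 'rV[R]_d)) enormZ normr0 mul0r. Qed.

Lemma enormN x : enorm (- x) = enorm x.
Proof. by rewrite -scaleN1r enormZ normrN1 mul1r. Qed.

Lemma enorm_distC x y : enorm (x - y) = enorm (y - x).
Proof. by rewrite -enormN opprB. Qed.

Lemma norm_le_enorm x : `|x| <= enorm x.
Proof.
apply: rV_norm_le => [|i]; first exact: enorm_ge0.
rewrite -(ler_sqr (normr_ge0 _) (enorm_ge0 _)) enorm_sqr real_normK ?num_real //.
rewrite /dot (bigD1 i) //= -expr2 lerDl sumr_ge0 // => j _.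
by rewrite -expr2 sqr_ge0.
Qed.

Lemma enorm_eq0 x : enorm x = 0 -> x = 0.
Proof.
by move=> x0; have := norm_le_enorm x; rewrite x0 normr_le0 => /eqP.
Qed.

Lemma enorm_le_norm x : enorm x <= d%:R * `|x|.
Proof.
rewrite -ler_sqr ?nnegrE ?enorm_ge0 ?mulr_ge0 // enorm_sqr.
apply: (@le_trans _ _ (d%:R * `|x| ^+ 2)).
  have -> : d%:R * `|x| ^+ 2 = \sum_(i < d) `|x| ^+ 2.
    by rewrite sumr_const card_ord mulr_natl.
  apply: ler_sum => i _.
  rewrite -expr2 -real_normK ?num_real // lerXn2r ?nnegrE //.
  exact: rV_coord_le.
rewrite exprMn ler_wpM2r ?sqr_ge0 // -natrX ler_nat.
by case: (d) => // n; rewrite expnS leq_pmulr.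
Qed.

(* With a = |x| and b = |y|, Cauchy-Schwarz in the termwise form
   (x_i + y_i)^2 <= (a + b) (x_i^2 / a + y_i^2 / b). *)
Lemma ler_enormD x y : enorm (x + y) <= enorm x + enorm y.
Proof.
have [/eqP/enorm_eq0 ->|x0] := boolP (enorm x == 0); first by rewrite enorm0 !add0r.
have [/eqP/enorm_eq0 ->|y0] := boolP (enorm y == 0); first by rewrite enorm0 !addr0.
have a0 : 0 < enorm x by rewrite lt_def x0 enorm_ge0.
have b0 : 0 < enorm y by rewrite lt_def y0 enorm_ge0.
set a := enorm x in a0 *; set b := enorm y in b0 *.
rewrite -ler_sqr ?nnegrE ?addr_ge0 ?enorm_ge0 // enorm_sqr.
have -> : (a + b) ^+ 2 = (a + b) * (dot x x / a + dot y y / b).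
  by rewrite -!enorm_sqr -/a -/b; field; rewrite !gt_eqF.
rewrite /dot !mulr_suml -big_split mulr_sumr; apply: ler_sum => i _ /=.
rewrite !mxE -subr_ge0.
rewrite (_ : _ - _ = (b * x 0 i - a * y 0 i) ^+ 2 / (a * b)); last first.
  by field; rewrite !gt_eqF.
by rewrite divr_ge0 ?sqr_ge0 // mulr_ge0 // ltW.
Qed.

Lemma ler_enorm_dist y x z : enorm (x - z) <= enorm (x - y) + enorm (y - z).
Proof. by rewrite -[x - z](subrKA y) ler_enormD. Qed.

Lemma stewart x y z (l : R) : enorm (z - x - l *: (y - x)) ^+ 2 =
  (1 - l) * enorm (z - x) ^+ 2 + l * enorm (z - y) ^+ 2
  - l * (1 - l) * enorm (y - x) ^+ 2.
Proof.
rewrite !enorm_sqr /dot !mulr_sumr -big_split -sumrB; apply: eq_bigr => i _ /=.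
by rewrite !mxE; ring.
Qed.

Lemma cvg_enormP (T : Type) (F : set_system T) (f : T -> 'rV[R]_d)
    (l : 'rV[R]_d) :
  Filter F -> f @ F --> l <->
    forall e : R, 0 < e -> \forall t \near F, enorm (f t - l) < e.
Proof.
move=> FF; split=> [/cvgr_dist_lt fl e e0|fl].
  (* The factor [d.+1] avoids division by 0 in dimension 0. *)
  have d0 : 0 < d.+1%:R :> R by rewrite ltr0n.
  have := fl (e / d.+1%:R) (divr_gt0 e0 d0); apply: filterS => t ft.
  rewrite enorm_distC (le_lt_trans (enorm_le_norm _)) //.
  apply: (@le_lt_trans _ _ (d.+1%:R * `|l - f t|)).
    by rewrite ler_wpM2r // ler_nat.
  by rewrite mulrC -ltr_pdivlMr.
apply/cvgrPdist_lt => e e0; apply: filterS (fl e e0) => t.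
by rewrite enorm_distC; apply: le_lt_trans; exact: norm_le_enorm.
Qed.

Lemma cvg_enorm (T : Type) (F : set_system T) (f : T -> 'rV[R]_d)
    (l : 'rV[R]_d) :
  Filter F -> f @ F --> l -> enorm (f t) @[t --> F] --> enorm l.
Proof.
move=> FF /cvg_enormP fl; apply/cvgrPdist_lt => e e0.
apply: filterS (fl e e0) => t; apply: le_lt_trans.
have h1 := ler_enormD (f t - l) l; have h2 := ler_enormD (l - f t) (f t).
rewrite subrK in h1; rewrite subrK enorm_distC in h2.
by rewrite ler_norml; apply/andP; split; lra.
Qed.

(* Stewart's identity shows that the affine relation between the points of a
   line is determined by their mutual distances. *)
Lemma similarity_collinear (f : 'rV[R]_d -> 'rV[R]_d) (r : R)
    (p v s s0 s1 : 'rV[R]_d) (t t0 t1 : R) : 0 < r ->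
  (forall x y, enorm (f x - f y) = r * enorm (x - y)) ->
  p + t *: v = f s -> p + t0 *: v = f s0 -> p + t1 *: v = f s1 ->
  (t1 - t0) *: (s - s0) = (t - t0) *: (s1 - s0).
Proof.
move=> r0 fr fs fs0 fs1.
have dist a b x y : p + a *: v = f x -> p + b *: v = f y ->
    enorm (x - y) = `|a - b| * (enorm v / r).
  move=> fx fy; apply: (mulfI (lt0r_neq0 r0)); rewrite -fr -fx -fy.
  rewrite opprD addrACA subrr add0r -scalerBl enormZ.
  by field; rewrite gt_eqF.
have [t10|t10] := eqVneq t1 t0.
  have := dist _ _ _ _ fs1 fs0; rewrite t10 subrr normr0 mul0r => /enorm_eq0 ->.
  by rewrite scale0r scaler0.
have t10' : t1 - t0 != 0 by rewrite subr_eq0.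
pose l := (t - t0) / (t1 - t0).
suff : s - s0 - l *: (s1 - s0) = 0.
  move/eqP; rewrite subr_eq0 => /eqP ->.
  by rewrite scalerA mulrC /l divfK.
apply: enorm_eq0; apply/eqP; rewrite -sqrf_eq0 stewart.
rewrite (dist _ _ _ _ fs fs0) (dist _ _ _ _ fs fs1) (dist _ _ _ _ fs1 fs0).
rewrite !exprMn !real_normK ?num_real // /l; apply/eqP; field.
by rewrite t10' gt_eqF.
Qed.

(* Normalized, [u] preserves dot products, so the images of the basis vectors
   form an orthogonal matrix. *)
Lemma similarity_surj (u : 'rV[R]_d -> 'rV[R]_d) (r : R) : 0 < r ->
  (forall x y, enorm (u x - u y) = r * enorm (x - y)) ->
  forall z, exists x, u x = z.
Proof.
move=> r0 ur z.
pose f x := r^-1 *: (u x - u 0).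
have fI x y : enorm (f x - f y) = enorm (x - y).
  rewrite /f -scalerBr opprB addrA subrK enormZ ur gtr0_norm ?invr_gt0 //.
  by rewrite mulKf // gt_eqF.
have f0 x : enorm (f x) = enorm x.
  have := fI x 0; rewrite subr0 => <-; congr enorm.
  by rewrite /f subrr scaler0 subr0.
have fdot x y : dot (f x) (f y) = dot x y.
  by have := enorm_sqrB (f x) (f y); rewrite fI !f0 enorm_sqrB; lra.
have dotd x i : dot x (delta_mx 0 i) = x 0 i.
  rewrite /dot (bigD1 i) //= mxE !eqxx mulr1 big1 ?addr0 // => j ji.
  by rewrite mxE (negPf ji) andbF mulr0.
pose M : 'M[R]_d := \matrix_(i, j) f (delta_mx 0 i) 0 j.
have MM : M *m M^T = 1%:M.
  apply/matrixP => i j; rewrite !mxE.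
  transitivity (dot (f (delta_mx 0 i)) (f (delta_mx 0 j))).
    by apply: eq_bigr => k _; rewrite !mxE.
  by rewrite fdot dotd !mxE eqxx /= eq_sym.
have MM' := mulmx1C MM.
pose w := r^-1 *: (z - u 0).
(* As [f] should act as multiplication by the orthogonal [M], this is the candidate preimage of [w].
   The dot products of its image with the rows of [M] confirm it. *)
exists (w *m M^T).
have : f (w *m M^T) *m M^T = w *m M^T.
  apply/rowP => i; rewrite [LHS]mxE.
  transitivity (dot (f (w *m M^T)) (f (delta_mx 0 i))).
    by apply: eq_bigr => k _; rewrite !mxE.
  by rewrite fdot dotd.
move=> /(congr1 (fun x => x *m M)); rewrite -!mulmxA MM' !mulmx1.
have rV0 : r^-1 != 0 by rewrite invr_neq0 // gt_eqF.
by move/(scalerI rV0)/addIr.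
Qed.
End EuclideanNorm.

(** * Limit sets of iterated function systems *)

Section Words.
Variables (R : realType) (d : nat) (E : finType) (u : E -> 'rV[R]_d -> 'rV[R]_d).
Variables (r : E -> R) (c C D : R).
Hypothesis u_sim : forall a x y, enorm (u a x - u a y) = r a * enorm (x - y).
Hypotheses (c_gt0 : 0 < c) (C_lt1 : C < 1) (D_ge0 : 0 <= D).
Hypothesis r_bounds : forall a, c <= r a <= C.
Hypothesis u_ball : forall a z, enorm z <= D -> enorm (u a z) <= D.

Definition word (w : seq E) (y : 'rV[R]_d) : 'rV[R]_d := foldr u y w.
Definition ratio (w : seq E) : R := \prod_(a <- w) r a.
Definition prefix_of (omega : nat -> E) (n : nat) : seq E :=
  [seq omega k | k <- iota 0 n].
Definition shift (omega : nat -> E) (n : nat) : nat -> E := fun k => omega (n + k)%N.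

Let r_gt0 a : 0 < r a.
Proof. by have /andP[ca _] := r_bounds a; exact: lt_le_trans ca. Qed.

Let r_le1 a : r a <= 1.
Proof. by have /andP[_ aC] := r_bounds a; rewrite (le_trans aC) // ltW. Qed.

Lemma ratio_gt0 w : 0 < ratio w.
Proof. by apply: prodr_gt0 => a _; exact: r_gt0. Qed.

Lemma ratio_cat w w' : ratio (w ++ w') = ratio w * ratio w'.
Proof. exact: big_cat. Qed.

Lemma ratio_le1 w : ratio w <= 1.
Proof.
rewrite /ratio; elim: w => [|a w IH]; rewrite ?big_nil // big_cons.
by rewrite mulr_ile1 ?r_le1 // ltW // ratio_gt0.
Qed.

Lemma word_cat w w' y : word (w ++ w') y = word w (word w' y).
Proof. exact: foldr_cat. Qed.

Lemma word_sim w x y : enorm (word w x - word w y) = ratio w * enorm (x - y).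
Proof.
rewrite /ratio; elim: w => [|a w IH] /=; first by rewrite big_nil mul1r.
by rewrite u_sim IH big_cons mulrA.
Qed.

Lemma word_inj w : injective (word w).
Proof.
move=> x y xy; apply/eqP; rewrite -subr_eq0; apply/eqP/enorm_eq0/eqP.
have := word_sim w x y; rewrite xy subrr enorm0 => /esym/eqP.
by rewrite mulf_eq0 gt_eqF ?ratio_gt0.
Qed.

Lemma word_surj w z : exists x, word w x = z.
Proof. exact: similarity_surj (ratio_gt0 w) (word_sim w) z. Qed.

Lemma word_ball w z : enorm z <= D -> enorm (word w z) <= D.
Proof. by move=> zD; elim: w => //= a w IH; exact: u_ball. Qed.

Lemma prefix_of_cat omega n m :
  prefix_of omega (n + m) = prefix_of omega n ++ prefix_of (shift omega n) m.
Proof.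
rewrite /prefix_of iotaD map_cat; congr (_ ++ _).
by rewrite -[n in iota (0 + n)]addn0 addnA iotaDl -map_comp.
Qed.

Lemma ratio_prefix_le omega n : ratio (prefix_of omega n) <= C ^+ n.
Proof.
rewrite /ratio big_map; elim: n => [|n IH]; first by rewrite big_nil.
rewrite -addn1 iotaD big_cat big_seq1 add0n exprD /=.
have /andP[_ rC] := r_bounds (omega n).
rewrite ler_pM // ?(ltW (r_gt0 _)) //.
by rewrite ltW // prodr_gt0.
Qed.

Let C_gt0 (omega : nat -> E) : 0 < C.
Proof.
have /andP[_ ] := r_bounds (omega 0%N); exact: lt_le_trans.
Qed.

Lemma enorm_diff_ball (x y : 'rV[R]_d) :
  enorm x <= D -> enorm y <= D -> enorm (x - y) <= 2 * D.
Proof.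
move=> xD yD; rewrite mulr_natl mulr2n (le_trans (ler_enormD _ _)) // enormN.
exact: lerD.
Qed.

Lemma prefix_diff_le omega n x y : enorm x <= D -> enorm y <= D ->
  enorm (word (prefix_of omega n) x - word (prefix_of omega n) y) <= C ^+ n * (2 * D).
Proof.
move=> xD yD; rewrite word_sim ler_pM ?enorm_ge0 ?ratio_prefix_le ?enorm_diff_ball //.
by rewrite ltW // ratio_gt0.
Qed.

Lemma geometric_small (e : R) : 0 < e -> (nat -> E) ->
  exists n, C ^+ n * (2 * D) < e.
Proof.
move=> e0 /C_gt0 C0.
have : (fun n => C ^+ n * (2 * D)) @ \oo --> (0 : R).
  rewrite -[X in _ --> X](mul0r (2 * D)); apply: cvgM; last exact: cvg_cst.
  by apply: cvg_expr; rewrite gtr0_norm.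
move=> /cvgr0Pnorm_lt/(_ e e0)[n _ /(_ n (leqnn n)) /= nn].
by exists n; exact: le_lt_trans (ler_norm _) nn.
Qed.

(** All terms from index [n] on lie in the image of the ball of radius [D] under the prefix of
    length [n], whose diameter is at most [C ^+ n * (2 * D)]. *)
Lemma coding_map_cvg omega :
  (fun n => word (prefix_of omega n) 0) @ \oo --> coding_map u omega.
Proof.
rewrite /coding_map.
have -> : (fun n => foldr (fun k y => u (omega k) y) 0 (iota 0 n)) =
    (fun n => word (prefix_of omega n) 0).
  by apply/funext => n; rewrite /word /prefix_of foldr_map.
apply/cauchy_cvgP/cauchy_exP => e e0.
have [n ne] := geometric_small e0 omega.
exists (word (prefix_of omega n) 0); exists n => // k /= nk.
rewrite mx_norm_ball /ball_ /= (le_lt_trans (norm_le_enorm _)) //.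
rewrite -(subnKC nk) prefix_of_cat word_cat.
by apply: le_lt_trans ne; apply: prefix_diff_le; rewrite ?word_ball ?enorm0.
Qed.

Lemma enorm_lim_le (F : set_system nat) (FF : ProperFilter F)
    (f : nat -> 'rV[R]_d) (l : 'rV[R]_d) (B : R) :
  f @ F --> l -> (\forall n \near F, enorm (f n) <= B) -> enorm l <= B.
Proof.
move=> /cvg_enormP fl fB; apply/ler_addgt0Pl => e e0.
have [n [fnB fnl]] := filter_ex (filterI fB (fl e e0)).
rewrite -(subrK (f n) l) (le_trans (ler_enormD _ _)) // lerD // enorm_distC.
exact: ltW.
Qed.

Lemma coding_map_ball omega : enorm (coding_map u omega) <= D.
Proof.
apply: (@enorm_lim_le \oo _ _ _ D (@coding_map_cvg omega)).
by apply: nearW => n; apply: word_ball; rewrite enorm0.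
Qed.

(** This allows a point of the limit set to be pulled back from the copy given by a prefix of its
    code, to another point of the limit set. *)
Lemma coding_map_shift omega n :
  coding_map u omega = word (prefix_of omega n) (coding_map u (shift omega n)).
Proof.
apply: (cvg_unique _ (@coding_map_cvg omega)) => //.
apply/cvg_enormP => e e0.
have /cvg_enormP/(_ e e0)[m _ me] := @coding_map_cvg (shift omega n).
exists (n + m)%N => // k /= nmk.
have kn : (n <= k)%N := leq_trans (leq_addr m n) nmk.
rewrite -(subnKC kn) prefix_of_cat word_cat word_sim.
apply: le_lt_trans (me (k - n)%N _); last by rewrite /= leq_subRL.
by rewrite ler_piMl ?enorm_ge0 // ratio_le1.
Qed.

Lemma coding_map_agree omega omega' n :
  (forall k, (k < n)%N -> omega k = omega' k) ->
  enorm (coding_map u omega - coding_map u omega') <= C ^+ n * (2 * D).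
Proof.
move=> agree; rewrite (coding_map_shift omega n) (coding_map_shift omega' n).
have -> : prefix_of omega' n = prefix_of omega n.
  by apply/eq_in_map => k; rewrite mem_iota add0n => /= kn; rewrite agree.
by apply: prefix_diff_le; exact: coding_map_ball.
Qed.
End Words.

(** * Copies of comparable size and their separation *)

Lemma prefix_or_diverge (E : eqType) (w w' : seq E) :
  [\/ prefix w w', prefix w' w |
      exists (v s s' : seq E) (a b : E),
        [/\ a != b, w = v ++ a :: s & w' = v ++ b :: s']].
Proof.
elim: w w' => [|a w IH] [|b w']; [exact: Or31|exact: Or31|exact: Or32|].
have [->|ab] := eqVneq a b; last first.
  by apply: Or33; exists [::], w, w', a, b.
case: (IH w') => [p|p|[v [s [s' [a' [b' [ab' -> ->]]]]]]].
- by apply: Or31; rewrite prefix_cons eqxx.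
- by apply: Or32; rewrite prefix_cons eqxx.
- by apply: Or33; exists (b :: v), s, s', a', b'.
Qed.

Section CutWords.
Variables (R : realType) (d : nat) (E : finType) (u : E -> 'rV[R]_d -> 'rV[R]_d).
Variables (r : E -> R) (c C D : R).
Hypothesis u_sim : forall a x y, enorm (u a x - u a y) = r a * enorm (x - y).
Hypotheses (c_gt0 : 0 < c) (C_lt1 : C < 1) (D_ge0 : 0 <= D).
Hypothesis r_bounds : forall a, c <= r a <= C.
Let wrd := word u.
Let rat := ratio r.

(* The words whose pieces have size comparable to [delta]: the first prefixes of
   ratio at most [delta]. *)
Definition cut (delta : R) (w : seq E) : Prop :=
  exists (w' : seq E) (a : E), w = rcons w' a /\ ratio r w <= delta < ratio r w'.

Let rat_gt0 w : 0 < rat w. Proof. exact: (ratio_gt0 c_gt0 r_bounds). Qed.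

Lemma cut_ratio_ge delta w : cut delta w -> c * delta <= rat w.
Proof.
move=> [w' [a [-> /andP[_ dw']]]].
rewrite /rat -cats1 ratio_cat {2}/ratio big_seq1 mulrC.
have /andP[ca _] := r_bounds a.
apply: (@le_trans _ _ (rat w' * c)); first by rewrite ler_pM2r // ltW.
by rewrite ler_pM2l.
Qed.

(** If [w'] properly extended [w], then [w'] without its last letter would still extend [w], and so
    have ratio at most [delta]. *)
Lemma cut_prefix delta w w' : cut delta w -> cut delta w' -> prefix w w' -> w = w'.
Proof.
move=> [v [a [wv /andP[rw _]]]] [v' [a' [-> /andP[_ rv']]]] /prefixP[t].
case/lastP: t => [|t b]; first by rewrite cats0.
rewrite -rcons_cat => /rcons_inj[v't _].
have := le_lt_trans rw rv'; rewrite v't ratio_cat ltNge ler_piMr //.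
  exact: ltW (rat_gt0 w).
exact: (ratio_le1 c_gt0 C_lt1 r_bounds).
Qed.

Lemma cut_exists delta omega : 0 < delta -> delta < 1 ->
  exists n, cut delta (prefix_of omega n).
Proof.
move=> delta0 delta1.
have ex : exists n, rat (prefix_of omega n) <= delta.
  have C0 : 0 < C.
    by have /andP[ca aC] := r_bounds (omega 0%N); rewrite (lt_le_trans c_gt0) // (le_trans ca).
  have /cvgr0Pnorm_lt/(_ _ delta0)[n _ /(_ n (leqnn n)) /= Cn] :
      (fun n => C ^+ n) @ \oo --> (0 : R) by apply: cvg_expr; rewrite gtr0_norm.
  exists n; rewrite (le_trans (ratio_prefix_le c_gt0 r_bounds _ _)) //.
  by rewrite (le_trans (ler_norm _)) // ltW.
(* The empty prefix has ratio 1, above [delta]; hence the least length is a successor. *)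
case: (ex_minnP ex) => -[|n] rn min_n.
  by move: rn; rewrite /rat /ratio /prefix_of /= big_nil leNgt delta1.
exists n.+1, (prefix_of omega n), (omega n); split.
  by rewrite /prefix_of -addn1 iotaD map_cat cats1.
by rewrite rn /= ltNge; apply/negP => /min_n; rewrite ltnn.
Qed.

Variables (W : set 'rV[R]_d) (y : 'rV[R]_d) (rho : R).
Hypothesis rho_gt0 : 0 < rho.
Hypothesis W_ball : forall z, enorm (z - y) < rho -> W z.
Hypothesis W_u : forall a, u a @` W `<=` W.
Hypothesis W_disj : trivIset [set: E] (fun a => u a @` W).

Let W_word w z : W z -> W (wrd w z).
Proof. by move=> Wz; elim: w => //= a w IH; apply: W_u; exists (wrd w z). Qed.

(** Distinct cut words diverge at some letter. Since similarities are onto, the image of the ball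
    about [y] under [w] is a full ball of radius [rat w * rho]; were [wrd w' y] in it, two disjoint
    first-level images of [W] would meet. *)
Lemma cut_separated delta w w' : cut delta w -> cut delta w' -> w != w' ->
  c * delta * rho <= enorm (wrd w y - wrd w' y).
Proof.
move=> cw cw' ww'.
have cr : c * delta <= rat w by exact: cut_ratio_ge.
apply: (@le_trans _ _ (rat w * rho)); first by rewrite ler_pM2r.
case: (prefix_or_diverge w w') => [pw|pw|[v [s [s' [a [b [ab wE w'E]]]]]]].
- by rewrite (cut_prefix cw cw' pw) eqxx in ww'.
- by rewrite (cut_prefix cw' cw pw) eqxx in ww'.
rewrite leNgt; apply/negP => close.
have [z wz] := word_surj u_sim c_gt0 r_bounds w (wrd w' y).
have Wz : W z.
  apply: W_ball; move: close; rewrite -[wrd w' y]wz enorm_distC.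
  by rewrite (word_sim u_sim) ltr_pM2l.
have : u a (wrd s z) = u b (wrd s' y).
  apply: (word_inj u_sim c_gt0 r_bounds (w := v)).
  by move: wz; rewrite /wrd wE w'E !word_cat.
have Wy : W y by apply: W_ball; rewrite subrr enorm0.
move=> uab; move/eqP: ab; apply.
apply: (W_disj (i := a) (j := b)) => //.
exists (u a (wrd s z)); split; first by exists (wrd s z) => //; exact: W_word.
by rewrite uab; exists (wrd s' y) => //; exact: W_word.
Qed.

(** The separated points lie in a ball of radius proportional to [delta]. Scaled by [kappa * delta]
    and translated, they fit in a cube of side [n]; two in one unit cube would be closer than
    [c * delta * rho], the factor [d.+1] paying for the change of norm. *)
Lemma cut_count (B : R) : exists M : nat, forall delta P (ws : seq (seq E)),
  0 < delta -> uniq ws ->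
  (forall w, w \in ws -> cut delta w /\ enorm (wrd w y - P) <= B * delta) ->
  (size ws <= M)%N.
Proof.
pose kappa := c * rho / d.+1%:R.
have k0 : 0 < kappa by rewrite !divr_gt0 ?mulr_gt0.
pose n := (Num.truncn (2 * B / kappa)).+1.
exists (n ^ d)%N => delta P ws delta0 uws cws.
rewrite leqNgt; apply/negP => szM.
have kd0 : 0 < kappa * delta by rewrite mulr_gt0.
pose w (i : 'I_(size ws)) := nth [::] ws i.
have ww i : w i \in ws by exact: mem_nth.
pose g i : 'rV[R]_d := (kappa * delta)^-1 *: (wrd (w i) y - P) + const_mx (B / kappa).
have gP i k : 0 <= g i 0 k < n%:R.
  have [_ closew] := cws _ (ww i).
  have : `|(wrd (w i) y - P) 0 k| <= B * delta.
    by rewrite (le_trans (rV_coord_le _ _)) // (le_trans (norm_le_enorm _)).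
  rewrite !mxE; set t := _ - _; rewrite ler_norml => /andP[t1 t2].
  have -> : (kappa * delta)^-1 * t + B / kappa = (t + B * delta) / (kappa * delta).
    by field; rewrite !gt_eqF.
  rewrite divr_ge0 ?(ltW kd0) //=; last by lra.
  apply: (@le_lt_trans _ _ (2 * B / kappa)); last exact: truncnS_gt.
  rewrite ler_pdivrMr // mulrA divfK ?gt_eqF //; lra.
have [i [j [ij gij]]] := box_pigeonhole szM gP.
have wij : w i != w j by rewrite nth_uniq // (ltn_eqF ij).
have := cut_separated (cws _ (ww i)).1 (cws _ (ww j)).1 wij.
apply/negP; rewrite -ltNge.
have -> : wrd (w i) y - wrd (w j) y = (kappa * delta) *: (g i - g j).
  rewrite /g opprD addrACA subrr addr0 -scalerBr scalerA mulfV ?gt_eqF // scale1r.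
  by rewrite opprB addrA subrK.
rewrite enormZ gtr0_norm // (le_lt_trans (ler_wpM2l (ltW kd0) (enorm_le_norm _))) //.
apply: (@lt_le_trans _ _ (kappa * delta * d.+1%:R)); last first.
  by rewrite /kappa mulrAC divfK ?gt_eqF // mulrAC lexx.
rewrite ltr_pM2l //.
apply: (@le_lt_trans _ _ d%:R); last by rewrite ltr_nat.
by rewrite ler_piMr // ltW.
Qed.
End CutWords.

(** * Limits along an ultrafilter and finite coverings *)

Lemma ultra_finite (U : set_system nat) (UU : UltraFilter U) (E : finType) (f : nat -> E) :
  exists a, \forall n \near U, f n = a.
Proof.
apply: contrapT => /forallNP no.
have {}no a : \forall n \near U, f n <> a.
  by case: (in_ultra_setVsetC [set n | f n = a] UU) => // /no.
have all_no : \forall n \near U, forall a, f n <> a by apply: filter_forall.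
by have [n /(_ (f n))] := filter_ex all_no.
Qed.

(** A finite form of Baire's theorem: either the first class is dense in the interval, or it misses
    a subinterval, which the other classes then cover. *)
Lemma somewhere_dense (R : realType) (T : R -> R -> Prop) (cs : seq R) (p q : R) :
  p < q -> (forall t, p <= t <= q -> exists2 c, c \in cs & T c t) ->
  exists c p' q', [/\ c \in cs, p <= p', p' < q', q' <= q &
    forall p'' q'', p' <= p'' -> p'' < q'' -> q'' <= q' ->
      exists2 t, p'' <= t <= q'' & T c t].
Proof.
elim: cs p q => [|c cs IH] p q pq cov.
  by have [|t] := cov p; first by rewrite lexx ltW.
have [dense|] := pselect (forall p'' q'', p <= p'' -> p'' < q'' -> q'' <= q ->
      exists2 t, p'' <= t <= q'' & T c t).
  by exists c, p, q; rewrite inE eqxx.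
move=> /existsNP[p'] /existsNP[q'] /not_implyP[pp'] /not_implyP[pq'] /not_implyP[qq'] no.
have [|c' [p1 [q1 [c'cs p'p1 pq1 qq1 dense]]]] := IH p' q' pq'.
  move=> t /andP[p't tq'].
  have [|c' + Tc't] := cov t; first by rewrite (le_trans pp') // (le_trans tq').
  rewrite inE => /orP[/eqP c'c|c'cs]; last by exists c'.
  by exfalso; apply: no; exists t; [rewrite p't|rewrite -c'c].
exists c', p1, q1; split => //; first by rewrite inE c'cs orbT.
- exact: le_trans p'p1.
- exact: le_trans qq'.
Qed.

Lemma ifs_constants (R : realType) d (E : finType) (u : E -> 'rV[R]_d -> 'rV[R]_d) :
  (forall a, contracting_similarity (u a)) ->
  exists (r : E -> R) (c C D : R),
    [/\ forall a x y, enorm (u a x - u a y) = r a * enorm (x - y),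
        [/\ 0 < c, C < 1 & 0 <= D], forall a, c <= r a <= C &
        forall a z, enorm z <= D -> enorm (u a z) <= D].
Proof.
move=> sim; pose r a := projT1 (cid (sim a)).
have rP a : [/\ 0 < r a, r a < 1 &
    forall x y, enorm (u a x - u a y) = r a * enorm (x - y)].
  by rewrite /r; case: cid.
(* The default [2^-1] ensures [0 < c] and [C < 1] even for empty [E]. *)
pose c := \big[Num.min/2^-1]_a r a.
pose C := \big[Num.max/2^-1]_a r a.
pose K := \big[Num.max/0]_a enorm (u a 0).
have c0 : 0 < c.
  apply: (big_ind (fun y : R => 0 < y)) => [|x y x0 y0|a _].
  - by rewrite invr_gt0.
  - by rewrite lt_min x0.
  - by have [] := rP a.
have C1 : C < 1.
  apply: (big_ind (fun y : R => y < 1)) => [|x y x0 y0|a _].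
  - by rewrite invf_lt1 // ltr1n.
  - by rewrite gt_max x0.
  - by have [] := rP a.
have K0 : 0 <= K.
  apply: (big_ind (fun y : R => 0 <= y)) => [|x y x0 y0|a _] //.
  - by rewrite le_max x0.
  - exact: enorm_ge0.
have C1' : 0 < 1 - C by rewrite subr_gt0.
have rC a : r a <= C by exact: le_bigmax.
(* This radius solves [C * D + K = D], where [K] bounds the images of 0, so every map keeps the
   ball. *)
exists r, c, C, (K / (1 - C)); split.
- by move=> a; have [] := rP a.
- by split=> //; rewrite divr_ge0 // ltW.
- move=> a; rewrite rC andbT; exact: bigmin_le.
move=> a z zD; rewrite -[u a z](subrK (u a 0)) (le_trans (ler_enormD _ _)) //.
have [r0 _ ->] := rP a; rewrite subr0.
have Ka : enorm (u a 0) <= K by exact: (le_bigmax _ (fun a => enorm (u a 0))).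
have : r a * enorm z <= C * (K / (1 - C)) by rewrite ler_pM ?enorm_ge0 // ltW.
have : C * (K / (1 - C)) + K = K / (1 - C) by field; rewrite gt_eqF.
lra.
Qed.

Section LimitSet.
Variables (R : realType) (d : nat) (E : finType) (u : E -> 'rV[R]_d -> 'rV[R]_d).
Variables (r : E -> R) (c C D : R).
Hypothesis u_sim : forall a x y, enorm (u a x - u a y) = r a * enorm (x - y).
Hypotheses (c_gt0 : 0 < c) (C_lt1 : C < 1) (D_ge0 : 0 <= D).
Hypothesis r_bounds : forall a, c <= r a <= C.
Hypothesis u_ball : forall a z, enorm z <= D -> enorm (u a z) <= D.
Variables (U : set_system nat) (UU : UltraFilter U).

(** Compactness of the limit set: the limit code is chosen letter by letter along [U], and codes
    that agree on a long prefix give close points. *)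
Lemma coding_map_ultra (omega : nat -> nat -> E) : exists omega' : nat -> E,
  coding_map u (omega n) @[n --> U] --> coding_map u omega'.
Proof.
pose omega' k := projT1 (cid (ultra_finite UU (fun n => omega n k))).
have omega'P k : \forall n \near U, omega n k = omega' k.
  by rewrite /omega'; case: cid.
exists omega'; apply/cvg_enormP => e e0.
have [m me] := @geometric_small _ _ _ _ _ D c_gt0 C_lt1 r_bounds _ e0 omega'.
have agree : \forall n \near U, forall k : 'I_m, omega n k = omega' k.
  by apply: filter_forall => k; exact: omega'P.
apply: filterS agree => n agree; apply: le_lt_trans me.
apply: (coding_map_agree u_sim c_gt0 C_lt1 D_ge0 r_bounds u_ball) => k km.
exact: (agree (Ordinal km)).
Qed.
End LimitSet.

(** A list of pairwise unrelated elements that does not cover [A] can be extended by an element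
    unrelated to all of them; the bound [M] stops this process. *)
Lemma finite_class_reps (T : eqType) (A : set T) (e : T -> T -> Prop) (M : nat) :
  (forall x, A x -> e x x) ->
  (forall cs : seq T, {in cs, forall x, A x} -> uniq cs ->
     {in cs &, forall x y, e x y -> x = y} -> (size cs <= M)%N) ->
  exists cs : seq T, {in cs, forall x, A x} /\
    forall x, A x -> exists2 y, y \in cs & e x y \/ e y x.
Proof.
move=> exx bound; apply: contrapT => nocover.
suff /(_ M.+1)[cs [csA ucs sep szM]] : forall k, exists cs : seq T,
    [/\ {in cs, forall x, A x}, uniq cs, {in cs &, forall x y, e x y -> x = y} &
        size cs = k].
  by have := bound cs csA ucs sep; rewrite szM ltnn.
elim=> [|k [cs [csA ucs sep szk]]]; first by exists [::].
have [x Ax xcs] : exists2 x, A x & forall y, y \in cs -> ~ (e x y \/ e y x).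
  apply: contrapT => nox; apply: nocover; exists cs; split=> // x Ax.
  apply: contrapT => noy; apply: nox; exists x => // y ycs xy.
  by apply: noy; exists y.
exists (x :: cs); split => /=.
- by move=> y; rewrite inE => /orP[/eqP ->|/csA].
- rewrite ucs andbT; apply/negP => /xcs; apply; left; exact: exx.
- move=> y z; rewrite !inE => /orP[/eqP ->|ycs] /orP[/eqP ->|zcs] // eyz.
  + by case: (xcs z zcs); left.
  + by case: (xcs y ycs); right.
  + exact: sep.
- by rewrite szk.
Qed.

(** * Chords that meet the limit set ever more densely *)

Section Chords.
Variables (R : realType) (d : nat) (E : finType) (u : E -> 'rV[R]_d -> 'rV[R]_d).
Variables (r : E -> R) (c C D : R).
Hypothesis u_sim : forall a x y, enorm (u a x - u a y) = r a * enorm (x - y).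
Hypotheses (c_gt0 : 0 < c) (C_lt1 : C < 1) (D_ge0 : 0 <= D).
Hypothesis r_bounds : forall a, c <= r a <= C.
Hypothesis u_ball : forall a z, enorm z <= D -> enorm (u a z) <= D.
Variables (W : set 'rV[R]_d) (y : 'rV[R]_d) (rho : R).
Hypothesis rho_gt0 : 0 < rho.
Hypothesis W_ball : forall z, enorm (z - y) < rho -> W z.
Hypothesis W_u : forall a, u a @` W `<=` W.
Hypothesis W_disj : trivIset [set: E] (fun a => u a @` W).
Variables (P Q : nat -> 'rV[R]_d).
Hypothesis PQ : forall n, P n <> Q n.
Hypothesis chords : forall n (t : R), 0 <= t <= 1 ->
  exists t', [/\ 0 <= t' <= 1, `|t - t'| <= n.+4%:R^-1 &
    limit_set u (P n + t' *: (Q n - P n))].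

Let l n := enorm (Q n - P n).
(** The size of the copies in which the chord is examined; since [l n <= 4 * D], it is below 1, as
    [cut_exists] requires. *)
Let delta n := l n / (4 * D + 1).

Let l_gt0 n : 0 < l n.
Proof.
rewrite lt_def enorm_ge0 andbT; apply/eqP => /enorm_eq0/eqP.
by rewrite subr_eq0 => /eqP /esym; exact: PQ.
Qed.

Let l_le n : l n <= 4 * D.
Proof.
have [|t0 [t00 t0e [w0 _ w0E]]] := @chords n 0; first by rewrite lexx ler01.
have [|t1 [t11 t1e [w1 _ w1E]]] := @chords n 1; first by rewrite lexx ler01.
have ball := coding_map_ball u_sim c_gt0 C_lt1 D_ge0 r_bounds u_ball.
have := enorm_diff_ball (ball w1) (ball w0).
rewrite w0E w1E opprD addrACA subrr add0r -scalerBl enormZ -/(l n).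
(* The offset 4 makes the samples near the two ends at least half a chord apart, while both lie in
   the ball of radius [D]. *)
have n4 : n.+4%:R^-1 <= 4^-1 :> R by rewrite lef_pV2 ?posrE ?ltr0n // ler_nat.
have t10 : 2^-1 <= `|t1 - t0|.
  apply: le_trans (ler_norm _).
  move: (le_trans t0e n4) (le_trans t1e n4); rewrite !ler_norml.
  by move=> /andP[? ?] /andP[? ?]; lra.
move=> le2D; have := le_trans (ler_wpM2r (ltW (l_gt0 n)) t10) le2D.
by move: (l n) => ?; lra.
Qed.

Let delta_gt0 n : 0 < delta n.
Proof. by rewrite divr_gt0 // ltr_wpDl // mulr_ge0. Qed.

Let delta_lt1 n : delta n < 1.
Proof. 
have D1 : 0 < 4 * D + 1 by rewrite ltr_wpDl // mulr_ge0.
by rewrite ltr_pdivrMr // mul1r (le_lt_trans (l_le n)) // ltrDl.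
 Qed.

(** The triple consists of a nearby parameter whose point is in the limit set, the word of a copy
    containing that point, and the code of the point pulled back from this copy. *)
Let sampled n t (data : R * seq E * (nat -> E)) : Prop :=
  [/\ 0 <= data.1.1 <= 1, `|t - data.1.1| <= n.+4%:R^-1, cut r (delta n) data.1.2 &
      P n + data.1.1 *: (Q n - P n) = word u data.1.2 (coding_map u data.2)].

Let sample_ex n t : 0 <= t <= 1 -> exists data, sampled n t data.
Proof.
move=> /(chords n)[t' [t'01 tt' [w _ wE]]].
have [k ck] := cut_exists c_gt0 C_lt1 r_bounds w (delta_gt0 n) (delta_lt1 n).
exists (t', prefix_of w k, shift w k); split => //=.
by rewrite -wE; exact: (coding_map_shift u_sim c_gt0 C_lt1 D_ge0 r_bounds u_ball).
Qed.

Lemma chords_contain_segment : contains_segment (limit_set u).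
Proof.
have /choice[data dataP] : forall nt : nat * R, exists data,
    0 <= nt.2 <= 1 -> sampled nt.1 nt.2 data.
  move=> [n t] /=; have [t01|] := boolP (0 <= t <= 1).
    by have [da] := sample_ex n t01; exists da.
  have [|da _] := @sample_ex n 0; first by rewrite lexx ler01.
  by exists da.
pose tau n t := (data (n, t)).1.1; pose w n t := (data (n, t)).1.2.
pose om n t := (data (n, t)).2; pose s n t := coding_map u (om n t).
have {}dataP n t : 0 <= t <= 1 -> [/\ 0 <= tau n t <= 1,
    `|t - tau n t| <= n.+4%:R^-1, cut r (delta n) (w n t) &
    P n + tau n t *: (Q n - P n) = word u (w n t) (s n t)].
  exact: (dataP (n, t)).
have [U [UU Uoo]] := ultraFilterLemma (F := \oo) _.
pose eqU t t' := \forall n \near U, w n t = w n t'.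
(* In units of [delta n], the term [enorm y + D] bounds the distance from the image of [y] to the
   sample, and [4 * D + 1] that from the sample to [P n]. *)
have [M countM] := cut_count u_sim c_gt0 C_lt1 r_bounds rho_gt0 W_ball W_u W_disj
  (enorm y + D + 4 * D + 1).
have ball := coding_map_ball u_sim c_gt0 C_lt1 D_ge0 r_bounds u_ball.
have center n t : 0 <= t <= 1 ->
    enorm (word u (w n t) y - P n) <= (enorm y + D + 4 * D + 1) * delta n.
  move=> t01; have [/andP[tau0 tau1] _ cw wE] := dataP n t t01.
  apply: le_trans (ler_enorm_dist (word u (w n t) (s n t)) _ _) _.
  rewrite (word_sim u_sim) -wE [P n + _]addrC addrK enormZ ger0_norm // -/(l n).
  have rw : ratio r (w n t) <= delta n by move: cw => [v [a [-> /andP[]]]].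
  have ys : enorm (y - s n t) <= enorm y + D.
    by rewrite (le_trans (ler_enormD _ _)) // enormN lerD2l ball.
  have h1 : ratio r (w n t) * enorm (y - s n t) <= delta n * (enorm y + D).
    by rewrite ler_pM ?enorm_ge0 // ltW // (ratio_gt0 c_gt0 r_bounds).
  have h2 : tau n t * l n <= l n by rewrite ler_piMl // ltW.
  have h3 : l n = (4 * D + 1) * delta n.
    by rewrite /delta mulrC divfK // gt_eqF // ltr_wpDl // mulr_ge0.
  have : tau n t * l n <= (4 * D + 1) * delta n by rewrite -h3.
  by move: h1; lra.
have [cs [cs01 cover]] : exists cs : seq R, {in cs, forall t, 0 <= t <= 1} /\
    forall t, 0 <= t <= 1 -> exists2 t', t' \in cs & eqU t t' \/ eqU t' t.
  apply: (finite_class_reps (M := M) (A := [set t : R | is_true (0 <= t <= 1)])).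
    by move=> t _; apply: nearW.
  move=> cs cs01 ucs sep.
  (* Parameters not identified by [U] have different words for almost all [n]. The list being
     finite, a single [n] separates all of them, and [countM] applies there. *)
  have [n inj] : exists n, {in cs &, injective (w n)}.
    have : \forall n \near U, forall tt : seq_sub cs * seq_sub cs,
        w n (ssval tt.1) = w n (ssval tt.2) -> ssval tt.1 = ssval tt.2.
      apply: filter_forall => -[[t tcs] [t' t'cs]] /=.
      have [wtt|wtt] := in_ultra_setVsetC [set n | w n t = w n t'] UU.
        by apply: nearW => n _; apply: sep.
      by apply: filterS wtt => n.
    move=> /filter_ex[n wn]; exists n => t t' tcs t'cs.
    exact: (wn (SeqSub tcs, SeqSub t'cs)).
  rewrite -(size_map (w n)); apply: (countM (delta n) (P n)) => //.
    by rewrite map_inj_in_uniq.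
  move=> _ /mapP[t tcs ->]; have t01 := cs01 t tcs; split; last exact: center.
  by have [] := dataP n t t01.
have [|c0 [p [q [c0cs p0 pq q1 dense]]]] := somewhere_dense (T := eqU) (cs := cs) (@ltr01 R).
  move=> t /cover[t' t'cs [tt'|tt']]; exists t' => //.
  by apply: filterS tt' => n ->.
have lim_ex t : exists om', s n t @[n --> U] --> coding_map u om'.
  exact: (coding_map_ultra u_sim c_gt0 C_lt1 D_ge0 r_bounds u_ball UU).
have /choice[lim limP] := lim_ex.
have small_cvg (f : nat -> R) (a : R) :
    (forall n, `|a - f n| <= n.+1%:R^-1) -> f n @[n --> U] --> a.
  move=> fa; apply/cvgrPdist_lt => e e0; apply: Uoo.
  exists (Num.truncn e^-1) => // n /= ne; apply: le_lt_trans (fa n) _.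
  rewrite invf_plt ?posrE ?ltr0n // (lt_le_trans (truncnS_gt _)) //.
  by rewrite ler_nat.
have tau_cvg t : 0 <= t <= 1 -> tau n t @[n --> U] --> t.
  move=> t01; apply: small_cvg => n; have [_ tt _ _] := dataP n t t01.
  apply: le_trans tt _; rewrite lef_pV2 ?posrE ?ltr0n // ler_nat.
  by rewrite -(addn3 n.+1) leq_addr.
have pq01 t : p <= t <= q -> 0 <= t <= 1.
  by move=> /andP[? ?]; apply/andP; split; lra.
(* For almost all [n] the three samples lie in the same copy, so the pulled back points satisfy the
   affine relation of the parameters [tau]; it passes to the limit. *)
have affine t t0 t1 : eqU c0 t -> eqU c0 t0 -> eqU c0 t1 -> p <= t <= q ->
    p <= t0 <= q -> p <= t1 <= q ->
    (t1 - t0) *: (coding_map u (lim t) - coding_map u (lim t0)) =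
    (t - t0) *: (coding_map u (lim t1) - coding_map u (lim t0)).
  move=> ct ct0 ct1 /pq01 t01 /pq01 t001 /pq01 t101.
  have lhs : (tau n t1 - tau n t0) *: (s n t - s n t0) @[n --> U] -->
      (t1 - t0) *: (coding_map u (lim t) - coding_map u (lim t0)).
    by apply: cvgZ; apply: cvgB => //; exact: tau_cvg.
  have rhs : (tau n t - tau n t0) *: (s n t1 - s n t0) @[n --> U] -->
      (t - t0) *: (coding_map u (lim t1) - coding_map u (lim t0)).
    by apply: cvgZ; apply: cvgB => //; exact: tau_cvg.
  apply: (cvg_unique _ lhs) => //.
  apply: cvg_trans rhs; apply: near_eq_cvg.
  apply: filterS (filterI ct (filterI ct0 ct1)) => n [/= wt [/= wt0 wt1]].
  have [_ _ _ e] := dataP n t t01; have [_ _ _ e0] := dataP n t0 t001.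
  have [_ _ _ e1] := dataP n t1 t101.
  rewrite -wt in e; rewrite -wt0 in e0; rewrite -wt1 in e1.
  apply/esym; exact: similarity_collinear (ratio_gt0 c_gt0 r_bounds _)
    (word_sim u_sim (w n c0)) e e0 e1.
(* The copy has ratio at most [delta n = l n / (4 * D + 1)], so pulling back restores distances to
   at least the differences of parameters. The limit segment is thus nondegenerate. *)
have expand t0 t1 : eqU c0 t0 -> eqU c0 t1 -> p <= t0 <= q -> p <= t1 <= q ->
    `|t1 - t0| <= enorm (coding_map u (lim t1) - coding_map u (lim t0)).
  move=> ct0 ct1 /pq01 t001 /pq01 t101.
  have lhs : `|tau n t1 - tau n t0| @[n --> U] --> `|t1 - t0|.
    by apply: cvg_norm; apply: cvgB; exact: tau_cvg.
  have rhs : enorm (s n t1 - s n t0) @[n --> U] -->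
      enorm (coding_map u (lim t1) - coding_map u (lim t0)).
    by apply: cvg_enorm; exact: cvgB.
  apply: (ler_cvg_to lhs rhs).
  apply: filterS (filterI ct0 ct1) => n [/= wt0 wt1].
  have [_ _ cw e0] := dataP n t0 t001; have [_ _ _ e1] := dataP n t1 t101.
  rewrite -wt0 in e0 cw; rewrite -wt1 in e1.
  have := word_sim u_sim (w n c0) (s n t1) (s n t0).
  rewrite -e0 -e1 opprD addrACA subrr add0r -scalerBl enormZ -/(l n) => tl.
  have rw : ratio r (w n c0) <= delta n by move: cw => [v [a [-> /andP[]]]].
  have D1 : 0 < 4 * D + 1 by rewrite ltr_wpDl // mulr_ge0.
  have := ler_wpM2r (enorm_ge0 (s n t1 - s n t0)) rw; rewrite -tl /delta => h.
  have : l n * (`|tau n t1 - tau n t0| * (4 * D + 1)) <=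
      l n * enorm (s n t1 - s n t0).
    by rewrite mulrA [l n * `|_|]mulrC -ler_pdivlMr // [l n * _ / _]mulrAC.
  rewrite ler_pM2l //; apply: le_trans; rewrite ler_peMr //.
  by rewrite lerDr mulr_ge0.
have [|||t0 /andP[pt0 t0p] c0t0] := dense p (p + (q - p) / 3); [lra|lra|lra|].
have [|||t1 /andP[qt1 t1q] c0t1] := dense (q - (q - p) / 3) q; [lra|lra|lra|].
have t01 : 0 < t1 - t0 by lra.
pose A := coding_map u (lim t0); pose B := coding_map u (lim t1).
exists A, B; split.
  have := expand t0 t1 c0t0 c0t1.
  rewrite -/A -/B => h AB; move: h; rewrite AB subrr enorm0 gtr0_norm //; lra.
move=> lam /andP[lam0 lam1].
pose T := t0 + lam * (t1 - t0).
have Tpq : p <= T <= q by rewrite /T; nra.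
(* The parameter [T] itself may be outside the dense class; it is approached by members of the
   class, and the compactness of the limit set provides a code for the limit point. *)
have near_ex (e : R) : 0 < e -> exists t, [/\ p <= t <= q, `|t - T| <= e & eqU c0 t].
  move=> e0; case/andP: Tpq => pT Tq.
  have [|||t /andP[]] := dense (Num.max p (T - e)) (Num.min q (T + e)).
  - by rewrite le_max lexx.
  - by rewrite gt_max !lt_min; apply/andP; split; apply/andP; split; lra.
  - by rewrite ge_min lexx.
  rewrite ge_max le_min => /andP[? ?] /andP[? ?] c0t; exists t; split => //.
    by apply/andP.
  by rewrite ler_norml; apply/andP; split; lra.
have /choice[tn tnP] : forall n : nat, exists t,
    [/\ p <= t <= q, `|t - T| <= n.+1%:R^-1 & eqU c0 t].
  by move=> n; apply: near_ex; rewrite invr_gt0.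
have [om' om'P] := coding_map_ultra u_sim c_gt0 C_lt1 D_ge0 r_bounds u_ball UU
  (fun n => lim (tn n)).
exists om' => //.
have tn_cvg : tn n @[n --> U] --> T.
  by apply: small_cvg => n; have [_ + _] := tnP n; rewrite distrC.
have : coding_map u (lim (tn n)) @[n --> U] --> (1 - lam) *: A + lam *: B.
  have -> : (fun n => coding_map u (lim (tn n))) =
      (fun n => A + ((tn n - t0) / (t1 - t0)) *: (B - A)).
    apply/funext => n; have [tnpq _ ctn] := tnP n.
    have := affine _ _ _ ctn c0t0 c0t1 tnpq.
    rewrite -/A -/B mulrC -scalerA => <- //; first last.
    - by apply/andP; split; lra.
    - by apply/andP; split; lra.
    by rewrite scalerA mulVf ?gt_eqF // scale1r subrKC.
  have -> : (1 - lam) *: A + lam *: B = A + ((T - t0) / (t1 - t0)) *: (B - A).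
    have -> : (T - t0) / (t1 - t0) = lam.
      by rewrite /T; field; rewrite gt_eqF.
    by apply/rowP => i; rewrite !mxE; ring.
  apply: cvgD; first exact: cvg_cst.
  apply: cvgZ; last exact: cvg_cst.
  apply: cvgM; last exact: cvg_cst.
  by apply: cvgB => //; exact: cvg_cst.
by apply: cvg_unique om'P.
Qed.
End Chords.

(** * Uniform gaps in chords and the conclusion *)

Lemma ifs_chord_gap (R : realType) d (S : set 'rV[R]_d) :
  is_ifs_limit_set S -> ~ contains_segment S ->
  exists n : nat, forall P Q, P <> Q -> exists2 t : R, 0 <= t <= 1 &
    forall t', 0 <= t' <= 1 -> `|t - t'| <= n.+4%:R^-1 -> ~ S (P + t' *: (Q - P)).
Proof.
move=> [E [u [[sim [W [oW [y Wy] uW dW]]] ->]]] noseg.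
have [r [c [C [D [u_sim [c0 C1 D0] rcC u_ball]]]]] := ifs_constants sim.
have /nbhs_rVP[rho rho0 rhoW] : nbhs y W by exact: open_nbhs_nbhs.
have W_ball z : enorm (z - y) < rho -> W z.
  by move=> zy; apply: rhoW; exact: le_lt_trans (norm_le_enorm _) zy.
apply: contrapT => /forallNP nogap; apply: noseg.
have /choice[PQ PQP] : forall n, exists PQ : 'rV[R]_d * 'rV[R]_d,
    PQ.1 <> PQ.2 /\ forall t, 0 <= t <= 1 -> exists t',
      [/\ 0 <= t' <= 1, `|t - t'| <= n.+4%:R^-1 &
          limit_set u (PQ.1 + t' *: (PQ.2 - PQ.1))].
  move=> n; have /existsNP[P /existsNP[Q /not_implyP[PQ no]]] := nogap n.
  exists (P, Q); split => // t t01; apply: contrapT => not'; apply: no.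
  exists t => // t' t'01 tt' St'; apply: not'; exists t'; split => //.
apply: (chords_contain_segment u_sim c0 C1 D0 rcC u_ball rho0 W_ball uW dW
  (P := fun n => (PQ n).1) (Q := fun n => (PQ n).2)).
  by move=> n; have [] := PQP n.
by move=> n t t01; have [_] := PQP n; apply.
Qed.

Lemma small_steps (R : realType) (f : nat -> R) (N : nat) (t e : R) :
  0 <= e -> f 0%N <= t -> t <= f N -> (forall i, (i < N)%N -> f i.+1 - f i <= e) ->
  exists2 i, (i <= N)%N & `|t - f i| <= e.
Proof.
move=> e0 f0t; elim: N => [|N IH] tf step.
  by exists 0%N => //; rewrite (le_anti (_ : f 0%N <= t <= f 0%N)) ?f0t // subrr normr0.
have [tN|tN] := leP t (f N).
  have [i iN ti] := IH tN (fun i iN => step i (leqW iN)).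
  by exists i => //; exact: leqW.
exists N => //; have := step N (ltnSn N).
by rewrite ler_norml => ?; apply/andP; split; lra.
Qed.

(** On the chord from index [k] to [k + k], each step is at most [2 / k] of the whole, for every
    [beta], because [1 + 2 * x_ k <= 2 * (1 + x_ k)]. With [k = 2 * n.+4] the points come within
    [n.+4%:R^-1] of every relative position, so one falls into the gap. The gap being relative to
    the chord, the radius can be 1. *)
Lemma ifs_leaves_lines (R : realType) d (S : set 'rV[R]_d) x :
  is_ifs_limit_set S -> ~ contains_segment S -> exists m, leaves_lines S x m.
Proof.
move=> ifsS /(ifs_chord_gap ifsS)[n gap].
pose k := (2 * n.+4)%N; have k0 : 0 < k%:R :> R by rewrite ltr0n.
exists (k + k)%N, 1 => // b v beta v0 beta0 _.
apply: contrapT => inS.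
have {}inS i : (i <= k + k)%N -> S (projective_point b v beta i).
  by move=> ik; apply: contrapT => nS; apply: inS; exists i.
pose x_ (i : nat) := i%:R * beta; pose th i := x_ i / (1 + x_ i).
have x0 i : 0 <= x_ i by rewrite mulr_ge0 // ltW.
have x1 i : 0 < 1 + x_ i by rewrite ltr_wpDr.
have xle i j : (i <= j)%N -> x_ i <= x_ j by move=> ij; rewrite ler_pM2r // ler_nat.
have thB i j : th j - th i = (x_ j - x_ i) / ((1 + x_ i) * (1 + x_ j)).
  by rewrite /th; field; rewrite !gt_eqF.
have thle i j : (i <= j)%N -> th i <= th j.
  move=> ij; rewrite -subr_ge0 thB divr_ge0 // ?subr_ge0 ?xle //.
  by rewrite mulr_ge0 // ltW.
pose L := th (k + k)%N - th k.
have xk0 : 0 < x_ k by rewrite mulr_gt0.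
have xkk : x_ (k + k)%N = x_ k + x_ k by rewrite /x_ natrD mulrDl.
have L0 : 0 < L.
  by rewrite /L thB xkk addrK divr_gt0 // mulr_gt0 // -xkk.
have step i : (k <= i)%N -> th i.+1 - th i <= 2 / k%:R * L.
  move=> ki; rewrite /L !thB.
  have -> : x_ i.+1 - x_ i = beta by rewrite /x_ -natr1; ring.
  rewrite xkk addrK mulrA (_ : 2 / k%:R * x_ k = 2 * beta); last first.
    by rewrite /x_; field; rewrite gt_eqF.
  rewrite ler_pdivrMr ?mulr_gt0 // mulrAC ler_pdivlMr ?mulr_gt0 // -?xkk //.
  have h1 := xle _ _ ki; have h2 := xle _ _ (leqW ki).
  rewrite xkk -mulrA mulrCA ler_pM2l //.
  have : (1 + x_ k) * (1 + (x_ k + x_ k)) <= (1 + x_ i) * (2 * (1 + x_ i.+1)).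
    by apply: ler_pM => //; lra.
  by lra.
have pE i : projective_point b v beta i =
    projective_point b v beta k + ((th i - th k) / L) *:
     (projective_point b v beta (k + k) - projective_point b v beta k).
  rewrite /projective_point -/(x_ i) -/(x_ k) -/(x_ (k + k)%N).
  rewrite -/(th i) -/(th k) -/(th (k + k)%N) opprD addrACA subrr add0r -scalerBl.
  by rewrite scalerA divfK ?gt_eqF // -addrA -scalerDl subrKC.
have [|t /andP[t0 t1] tgap] :=
  gap (projective_point b v beta k) (projective_point b v beta (k + k)).
  move/addrI/eqP; rewrite -subr_eq0 -scalerBl scaler_eq0 (negPf v0) orbF.
  rewrite -opprB oppr_eq0 -/(x_ k) -/(x_ (k + k)%N) -/(th k) -/(th (k + k)%N) -/L.
  by rewrite gt_eqF.
have [||||j jk tj] := @small_steps _ (fun j => (th (k + j)%N - th k) / L) k t n.+4%:R^-1.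
- by rewrite invr_ge0.
- by rewrite addn0 subrr mul0r.
- by rewrite -/L divff // gt_eqF.
- move=> j jk; rewrite -mulrBl opprB addrA subrK addnS ler_pdivrMr //.
  apply: le_trans (step _ (leq_addr _ _)) _.
  rewrite ler_pM2r // /k natrM invfM mulrA divff ?mul1r // pnatr_eq0 //.
apply: (tgap ((th (k + j)%N - th k) / L)) => //.
  rewrite divr_ge0 ?(ltW L0) ?subr_ge0 ?thle ?leq_addr //=.
  by rewrite ler_pdivrMr // mul1r lerD2r thle // leq_add2l.
by rewrite -pE; apply: inS; rewrite leq_add2l.
Qed.

Theorem theorem1p1 (R : realType) (d : nat) (hd : (0 < d)%N)
    (S : set 'rV[R]_d)
    (hS : is_ifs_limit_set S \/ analytic_submanifold S)
    (hseg : ~ contains_segment S) :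
  exists C : 'rV[R]_d -> R,
    (forall x, (S `\` rational_points R d) x ->
       0 < C x /\ infinite_set (extrinsic_approximants S x (C x))) /\
    (forall K : set 'rV[R]_d, compact K -> K `<=` S ->
       exists M : R, forall x, (K `\` rational_points R d) x -> C x <= M).
Proof.
apply: extrinsic_approximation => // x Sx; case: hS => [ifsS|manS].
  exact: ifs_leaves_lines.
exact: analytic_submanifold_leaves_lines.
Qed.
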